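(* Let $p,q,r\in[0,1]$ with $p+q+r=1$ and $0<r<1$, let $s\in[0,1]$, and let $(X_n)_{n\ge 1}$ be the steps of the elephant random walk with stops (ERWS) with parameters $p,q,r,s$. Let $\Sigma_n=\sum_{k=1}^n X_k^2$. Then $$\lim_{n\to\infty}\frac{1}{n^{1-r}}\Sigma_n=\Sigma\qquad\text{almost surely},$$ where $\Sigma$ is a random variable having a Mittag-Leffler distribution with parameter $1-r$. Consequently, $\Sigma$ is positive with probability one. Moreover, this convergence holds in $\mathbb{L}^m$ for every integer $m\ge 1$. Hence, for every integer $m\ge1$, $$\mathbb{E}[\Sigma^m]=\frac{m!}{\Gamma(1+m(1-r))}.$$
   Context: The elephant random walk with stops (ERWS) is defined as follows. The parameters are $p,q,r\in[0,1]$ with $p+q+r=1$, where $0<r<1$ is assumed throughout, and $s\in[0,1]$. The first step $X_1$ equals $+1$ with probability $s$ and $-1$ with probability $1-s$. For each $n\ge 1$, given $X_1,\dots,X_n$, an integer $k$ is chosen uniformly at random in $\{1,\dots,n\}$ and, independently of this choice and of the past, $X_{n+1}=X_k$ with probability $p$, $X_{n+1}=-X_k$ with probability $q$, and $X_{n+1}=0$ with probability $r$. The number of ones up to time $n$ is $\Sigma_n=\sum_{k=1}^n X_k^2$. A random variable $X$ has a Mittag-Leffler distribution with parameter $\alpha\in[0,1]$ if its Laplace transform is $\mathbb{E}[\exp(tX)]=\sum_{n=0}^\infty \frac{t^n}{\Gamma(1+n\alpha)}$ (for $0<\alpha\le 1$ this holds for all $t\in\mathbb{R}$); equivalently $\mathbb{E}[X^m]=\frac{m!}{\Gamma(1+m\alpha)}$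 for all integers $m\ge1$, and these moments characterize the distribution. $\Gamma$ is the Euler Gamma function. *)

(* Defs.v *)
From HB Require Import structures.
From mathcomp Require Import all_boot all_order all_algebra.
From mathcomp Require Import all_classical all_reals all_analysis.
Import Order.TTheory GRing.Theory Num.Theory.
Import numFieldNormedType.Exports.

Set Implicit Arguments.
Unset Strict Implicit.
Unset Printing Implicit Defensive.

Local Open Scope classical_set_scope.
Local Open Scope ring_scope.

(* Euler's integral, meaningful for 0 < x. *)
Definition Gamma (R : realType) (x : R) : R :=
  \int[lebesgue_measure]_(t in `]0, +oo[) (t `^ (x - 1) * expR (- t)).

(* Law of the sign applied to the remembered step: +1 repeats it, -1 reverses
   it and 0 is a stop. *)
Definition sign_pmf (R : realType) (p q r e : R) : R :=
  p *+ (e == 1) + q *+ (e == -1) + r *+ (e == 0).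

(* Steps are numbered from 1; X 0 is unconstrained and never used.
   K n is the time remembered, and E n the sign applied to the step remembered,
   when X n.+1 is drawn. The last clause says that, given X 1, ..., X n, the
   time K n is uniform on {1, ..., n}, and that E n has law sign_pmf and is
   independent of K n and of X 1, ..., X n; the right-hand sides sum to 1, so
   no other value is taken with positive probability. *)
Definition ERWS d (T : measurableType d) (R : realType) (P : probability T R)
    (p q r s : R) (X : nat -> {RV P >-> R}) : Prop :=
  [/\ P [set w | X 1%N w = 1] = s%:E,
      P [set w | X 1%N w = -1] = (1 - s)%:E &
      exists (K : nat -> {RV P >-> nat}) (E : nat -> {RV P >-> R}),
      forall n : nat, (1 <= n)%N ->
        {ae P, forall w, X n.+1 w = E n w * X (K n w) w} /\
        forall (x : nat -> R) (k : nat) (e : R), (1 <= k <= n)%N ->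
          let past := [set w | forall i, (1 <= i <= n)%N -> X i w = x i] in
          P (past `&` [set w | K n w = k] `&` [set w | E n w = e]) =
          (P past * (n%:R^-1)%:E * (sign_pmf p q r e)%:E)%E].

Definition number_of_ones d (T : measurableType d) (R : realType)
    (P : probability T R) (X : nat -> {RV P >-> R}) (n : nat) (w : T) : R :=
  \sum_(1 <= k < n.+1) X k w ^+ 2.

(* For alpha = 0 the series converges only for |t| < 1. *)
Definition Mittag_Leffler d (T : measurableType d) (R : realType)
    (P : probability T R) (alpha : R) (Y : {RV P >-> R}) : Prop :=
  forall t : R, 0 < alpha \/ `|t| < 1 ->
    (\sum_(0 <= n < N) (t ^+ n / Gamma (1 + n%:R * alpha)))%:E @[N --> \oo] -->
    'M_P Y t.

Definition cvg_Lm d (T : measurableType d) (R : realType)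
    (P : probability T R) (m : nat) (Y : nat -> T -> R) (Z : T -> R) : Prop :=
  [/\ forall n, Y n \in Lfun P (m%:R)%:E,
      Z \in Lfun P (m%:R)%:E &
      'N[P]_((m%:R)%:E)[EFin \o (fun w => (Y n w - Z w)%R)]%E @[n --> \oo] --> 0%E].

(* Main.v *)
Require Import Defs.
From mathcomp Require Import all_boot all_order all_algebra.
From mathcomp Require Import all_classical all_reals all_analysis.
From mathcomp Require Import measurable_realfun ring lra.
Import Order.TTheory GRing.Theory Num.Theory.
Import numFieldNormedType.Exports.

(** Write a = 1 - r and let S_n be the number of nonzero steps among the first
    n. The next step is nonzero exactly when the remembered step is nonzero and
    its sign is not 0; given the past, this has probability a S_n / n. So S is a
    Markov chain started from 1, and nothing else about the walk matters
    ([ERWS_ones_chain]).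

    The chain has explicit martingales. If j (phi (j + 1) - phi j) = lam phi j
    for every j, then E [phi (S_n)] is multiplied by 1 + a lam / n at time n
    ([Ex_eigen]), and by Euler's limit formula for Gamma the product of the
    factors 1 + x / k up to n is equivalent to n^x / Gamma (1 + x)
    ([euler_prod_cvg]). Rising factorials are eigenfunctions, and they serve
    three purposes.

    - The rising factorial of order m has lam = m. It yields the limit of
      E [S_n^m] / n^(a m), namely m! / Gamma (1 + a m).
    - The orders 1 and 2 together bound the second moment of the increments of
      the martingale attached to S ([Ex_increment_sqr]) by the inverse of the
      Euler product, of order n^(-a). Along the times (k + 1)^L with L a >= 4 the
      mean increments are summable, hence the martingale converges almost surely
      along this subsequence; since S is nondecreasing and consecutive times
      have ratio tending to 1, S_n / n^a converges along all integers
      ([ae_cvg_nb_ones]).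
    - A rising factorial of order -1/2 has lam = -1/2 and behaves like
      j^(-1/2). Its expectation at S_n is O (n^(-a/2)), so by Fatou's lemma the
      limit Sigma of S_n / n^a cannot vanish with positive probability
      ([ones_limit_gt0]).

    All moments of S_n / n^a being bounded, the almost sure convergence improves
    to convergence of the moments and to convergence in every L^m ([Ex_cvg0]).
    Finally Gamma (1 + n a) grows faster than any geometric sequence, so that the
    exponential series of t Sigma can be integrated term by term
    ([ones_limit_mgf]). *)

Set Implicit Arguments.
Unset Strict Implicit.
Unset Printing Implicit Defensive.

Local Open Scope classical_set_scope.
Local Open Scope ring_scope.

(** * The Gamma integral *)

(** Raise u <= exp u, taken at u = t / (2 x), to the power x: half of the
    exponential pays for the power and the other half stays integrable. *)
Lemma powR_expRN_le (R : realType) (x t : R) : 0 <= x -> 0 <= t ->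
  t `^ x * expR (- t) <= (2 * x) `^ x * expR (- 2^-1 * t).
Proof.
move=> x0 t0; have [->|xn0] := eqVneq x 0.
  rewrite !powRr0 !mul1r ler_expR; lra.
have {}x0 : 0 < x by rewrite lt_neqAle eq_sym xn0.
have -> : expR (- 2^-1 * t) = expR (2^-1 * t) * expR (- t) :> R.
  by rewrite -expRD; congr expR; lra.
rewrite mulrA ler_wpM2r ?expR_ge0//.
have -> : 2^-1 * t = t / (2 * x) * x by field; lra.
rewrite expRM -powRM ?expR_ge0//; last by lra.
apply: ge0_ler_powR => //; rewrite ?nnegrE ?(ltW x0)//.
  by rewrite mulr_ge0// ?expR_ge0//; lra.
have h : t / (2 * x) <= expR (t / (2 * x)).
  by apply: le_trans (expR_ge1Dx _); lra.
have : 2 * x * (t / (2 * x)) <= 2 * x * expR (t / (2 * x)).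
  by apply: ler_wpM2l h; lra.
by rewrite mulrC divfK//; lra.
Qed.

Lemma integrable_EFinM (R : realType) d (T : measurableType d)
    (m : {measure set T -> \bar R}) (D : set T) (c : R) (f : T -> R) :
  measurable D -> m.-integrable D (EFin \o f) ->
  m.-integrable D (EFin \o (fun t => c * f t)).
Proof. by move=> mD fi; have := integrableZl mD c fi. Qed.

Lemma integrable_EFinD (R : realType) d (T : measurableType d)
    (m : {measure set T -> \bar R}) (D : set T) (f g : T -> R) :
  measurable D -> m.-integrable D (EFin \o f) -> m.-integrable D (EFin \o g) ->
  m.-integrable D (EFin \o (fun t => f t + g t)).
Proof. by move=> mD fi gi; have := integrableD mD fi gi. Qed.

Section gamma_integral.
Variable R : realType.
Local Notation mu := (@lebesgue_measure R).

Lemma measurable_gamma_density (x : R) (D : set R) : measurable D ->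
  measurable_fun D (fun t : R => t `^ x * expR (- t)).
Proof.
move=> mD; apply: measurable_funTS.
apply: measurable_funM.
  exact: measurable_powR.
by apply: measurableT_comp => //; exact: measurable_funN.
Qed.

Lemma integrable_gamma_density (x : R) : 0 <= x ->
  mu.-integrable `[0, +oo[ (EFin \o (fun t => t `^ x * expR (- t))).
Proof.
move=> x0.
have h2 : (0:R) < 2^-1 by lra.
have hi : mu.-integrable `[0, +oo[ (fun t => ((2 * x) `^ x * 2)%:E * (EFin \o
  exponential_pdf 2^-1) t)%E.
  apply: integrableZl => //.
  apply: (@integrableS _ _ _ mu setT) => //.
  exact: integrable_exponential_pdf.
apply: (le_integrable _ _ _ hi) => //.
  by apply/measurable_EFinP; exact: measurable_gamma_density.
move=> t /=; rewrite in_itv/= andbT => t0.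
rewrite lee_fin exponential_pdfE//.
rewrite !ger0_norm ?mulr_ge0 ?powR_ge0 ?expR_ge0 ?invr_ge0//.
apply: (le_trans (@powR_expRN_le R x t x0 t0)).
by rewrite -[leRHS]mulrA (mulrA 2) divff ?mul1r ?pnatr_eq0.
Qed.

(** The argument of Gamma is written 1 + x throughout: for x >= 0 the integrand
    t^x exp (- t) is continuous at 0, so that the half-line can be closed and the
    fundamental theorem of calculus applies down to 0. *)
Lemma Gamma1E (x : R) : 0 <= x ->
  Gamma (1 + x) = \int[mu]_(t in `[0, +oo[) (t `^ x * expR (- t)).
Proof.
move=> x0; rewrite /Gamma addrC addKr Rintegral_itv_obnd_cbnd//.
apply: (@integrableS _ _ _ mu `[0, +oo[) => //; last exact: integrable_gamma_density.
by apply: subset_itvr; rewrite bnd_simp.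
Qed.

Lemma continuous_expRN : continuous (fun t : R => expR (- t)).
Proof.
move=> t; apply: continuous_comp; last exact: continuous_expR.
by apply: continuousN; exact: cvg_id.
Qed.

Lemma within_continuous_powR (x : R) : 0 <= x ->
  {within `[0, +oo[, continuous (fun t : R => t `^ x)}.
Proof.
move=> x0; have [->|xn0] := eqVneq x 0.
  rewrite (_ : (fun t : R => t `^ 0) = cst 1); last by apply/funext => t; rewrite powRr0.
  by apply: continuous_subspaceT => ?; exact: cst_continuous.
apply/continuous_within_itvcyP; split.
  move=> t; rewrite in_itv/= andbT => t0.
  apply: differentiable_continuous; apply/derivable1_diffP.
  by apply: derivable_powR; rewrite in_itv/= t0.
by rewrite powR0//; apply: powR_cvg0; rewrite lt_neqAle eq_sym xn0.
Qed.

Lemma gamma_density_cvg0 (x : R) : 0 <= x ->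
  t `^ x * expR (- t) @[t --> +oo] --> (0 : R).
Proof.
move=> x0.
apply: (@squeeze_cvgr _ _ _ _ (cst 0) (fun t => (2 * x) `^ x * expR (- (2^-1 * t)))).
- near=> t; rewrite mulr_ge0 ?powR_ge0 ?expR_ge0//= -mulNr.
  by apply: powR_expRN_le => //; near: t; exact: nbhs_pinfty_ge.
- exact: cvg_cst.
- rewrite -[X in _ --> X](mulr0 ((2 * x) `^ x)); apply: cvgMr.
  apply: (@cvg_comp _ _ _ (fun z => 2^-1 * z) (fun z => expR (- z)) _ (pinfty_nbhs R));
    last exact: cvgr_expR.
  by apply: gt0_cvgMry.
Unshelve. all: by end_near. Qed.

(** The factor t^0 puts the exponential in the shape of a Gamma integrand. *)
Lemma Rintegral_expRN (A : R) :
  \int[mu]_(t in `[A, +oo[) (t `^ 0 * expR (- t)) = expR (- A).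
Proof.
under eq_Rintegral do rewrite powRr0 mul1r.
rewrite (@Rintegral_ge0_continuous_FTC2y _ _ (fun t => - expR (- t)) _ 0)//.
- by rewrite sub0r opprK.
- by apply: continuous_subspaceT; exact: continuous_expRN.
- by rewrite -[X in _ --> X]oppr0; apply: cvgN; exact: cvgr_expR.
- by apply: cvgN; apply: cvg_at_right_filter; exact: continuous_expRN.
- move=> t _; rewrite derive1E derive_val /GRing.scale/=; lra.
Qed.

Lemma Gamma1_0 : Gamma (1 + 0) = 1 :> R.
Proof. by rewrite Gamma1E// Rintegral_expRN oppr0 expR0. Qed.

Lemma Gamma1_ge0 (x : R) : 0 <= x -> 0 <= Gamma (1 + x).
Proof.
move=> x0; rewrite Gamma1E//; apply: Rintegral_ge0 => t _.
by rewrite mulr_ge0 ?powR_ge0 ?expR_ge0.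
Qed.

(** Integration by parts as a single use of the fundamental theorem of calculus
    on a half-line, which needs an integrand of constant sign. The derivative of
    - t^(x + 1) exp (- t) changes sign at t = x + 1; that of
    - (t^(x + 1) + C) exp (- t) does not, as soon as C bounds the function
    (x + 1) t^x - t^(x + 1), and the additional integral is C. *)
Lemma Gamma1S (x : R) : 0 <= x -> Gamma (1 + (x + 1)) = (x + 1) * Gamma (1 + x).
Proof.
move=> x0; set C := (x + 1) `^ (x + 1).
have x1 : 0 <= x + 1 by lra.
pose g t : R := t `^ (x + 1) * expR (- t) + C * (t `^ 0 * expR (- t)) - (x + 1) * (t `^
  x * expR (- t)).
have iC : mu.-integrable `[0, +oo[ (EFin \o (fun t : R => C * (t `^ 0 * expR (- t)))).
  by apply: integrable_EFinM; [|exact: integrable_gamma_density].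
have ix : mu.-integrable `[0, +oo[ (EFin \o (fun t => (x + 1) * (t `^ x * expR (- t)))).
  by apply: integrable_EFinM; [|exact: integrable_gamma_density].
have i1 := integrable_gamma_density x1.
have i2 : mu.-integrable `[0, +oo[
  (EFin \o (fun t => t `^ (x + 1) * expR (- t) + C * (t `^ 0 * expR (- t)))).
  exact: integrable_EFinD.
have : \int[mu]_(t in `[0, +oo[) g t = C.
  rewrite (@Rintegral_ge0_continuous_FTC2y _ _
     (fun t => - (t `^ (x + 1) * expR (- t) + C * (t `^ 0 * expR (- t)))) _ 0)//.
  - by rewrite powR0 ?lt0r_neq0 ?ltr_wpDl// oppr0 expR0 powRr0; lra.
  - move=> t t0; rewrite /g powRr0 mul1r.
    have -> : t `^ (x + 1) * expR (- t) + C * expR (- t) - (x + 1) * (t `^ x * expR (- t))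
      = (t `^ (x + 1) + C - (x + 1) * t `^ x) * expR (- t) by ring.
    rewrite mulr_ge0 ?expR_ge0//.
    rewrite /C !powRD; try (apply/implyP => /eqP h; lra).
    rewrite !powRr1//.
    have [tx|xt] := leP t (x + 1).
      have : t `^ x <= (x + 1) `^ x by apply: ge0_ler_powR => //; rewrite nnegrE.
      have := powR_ge0 t x.
      by nra.
    have := powR_ge0 t x; have := powR_ge0 (x + 1) x; nra.
  - have cE : {within `[0, +oo[, continuous (fun t : R => expR (- t))}.
      by apply: continuous_subspaceT; exact: continuous_expRN.
    move=> t; apply: cvgB; [apply: cvgD|].
    + by apply: cvgM; [exact: within_continuous_powR|exact: cE].
    + by apply: cvgMr; apply: cvgM; [exact: within_continuous_powR|exact: cE].
    + by apply: cvgMr; apply: cvgM; [exact: within_continuous_powR|exact: cE].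
  - rewrite -[X in _ --> X]oppr0; apply: cvgN; rewrite -[X in _ --> X]addr0.
    apply: cvgD; first exact: gamma_density_cvg0.
    by rewrite -[X in _ --> X](mulr0 C); apply: cvgMr; exact: gamma_density_cvg0.
  - move=> t t0; apply: derivableN; apply: derivableD.
      by apply: derivableM; [apply: derivable_powR; rewrite in_itv/= t0|].
    apply: derivableM => //.
    by apply: derivableM; [apply: derivable_powR; rewrite in_itv/= t0|].
  - have cE : {within `[0, +oo[, continuous
      (fun t : R => - (t `^ (x + 1) * expR (- t) + C * (t `^ 0 * expR (- t))))}.
      have cE : {within `[0, +oo[, continuous (fun t : R => expR (- t))}.
        by apply: continuous_subspaceT; exact: continuous_expRN.
      move=> t; apply: cvgN; apply: cvgD.
      + by apply: cvgM; [exact: within_continuous_powR|exact: cE].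
      + by apply: cvgMr; apply: cvgM; [exact: within_continuous_powR|exact: cE].
    by move/continuous_within_itvcyP : cE => [].
  - move=> t; rewrite in_itv/= andbT => t0.
    rewrite derive1E; rewrite /g powRr0.
    under eq_fun do rewrite powRr0.
    have d1 := is_derive1_powR (x + 1) t0.
    rewrite derive_val /GRing.scale/= addrK; lra.
rewrite /g RintegralB// RintegralD// RintegralZl//; last exact: integrable_gamma_density.
rewrite RintegralZl//; last exact: integrable_gamma_density.
by rewrite -!Gamma1E// Gamma1_0; lra.
Qed.

(* weighted arithmetic-geometric mean, in the form of Bernoulli's inequality *)
(** Young's inequality for the product of u^x and 1, with the conjugate exponents
    1 / x and 1 / (1 - x). *)
Lemma powR_bernoulli (u x : R) : 0 <= u -> 0 <= x <= 1 -> u `^ x <= 1 + x * (u - 1).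
Proof.
move=> u0 /andP[x0 x1].
have [->|xn0] := eqVneq x 0; first by rewrite powRr0; lra.
have [->|xn1] := eqVneq x 1; first by rewrite powRr1//; lra.
have {}x0 : 0 < x by rewrite lt_neqAle eq_sym xn0.
have {xn1}x1 : x < 1 by rewrite lt_neqAle xn1.
have := @conjugate_powR R (u `^ x) 1 x^-1 (1 - x)^-1.
rewrite powR_ge0 ler01 !invr_gt0 !invrK -powRrM mulfV ?gt_eqF// powRr1// powR1 => H.
by have := H isT isT x0; rewrite mulr1 mul1r; lra.
Qed.

(** For the weight t^y exp (- t) the mean of t is y + 1, and the concave power u^x
    lies below its tangent at u = 1; take u = t / (y + 1) and integrate. This
    one-sided bound replaces the log-convexity of Gamma. *)
Lemma Gamma1D_le (y x : R) : 0 <= y -> 0 <= x <= 1 ->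
  Gamma (1 + (y + x)) <= (y + 1) `^ x * Gamma (1 + y).
Proof.
move=> y0 x01; have [x0 x1] := andP x01.
have y1 : 0 < y + 1 by lra.
pose c := (y + 1) `^ x.
have -> : (y + 1) `^ x * Gamma (1 + y) = c * (1 - x) * Gamma (1 + y) + c * x / (y + 1)
  * Gamma (1 + (y + 1)).
  by rewrite Gamma1S// /c; field; lra.
rewrite !Gamma1E//; try lra.
have i1 := integrable_gamma_density y0.
have i2 := integrable_gamma_density (ltW y1).
have j1 : mu.-integrable `[0, +oo[ (EFin \o (fun t : R => c * (1 - x) * (t `^ y * expR
  (- t)))).
  exact: integrable_EFinM.
have j2 : mu.-integrable `[0, +oo[ (EFin \o (fun t : R => c * x / (y + 1) * (t `^ (y +
  1) * expR (- t)))).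
  exact: integrable_EFinM.
rewrite -!RintegralZl// -RintegralD//.
apply: le_Rintegral => //.
- by apply: integrable_gamma_density; lra.
- exact: integrable_EFinD.
- move=> t; rewrite /= in_itv/= andbT => t0.
  rewrite !mulrA -mulrDl ler_wpM2r ?expR_ge0//.
  have [->|tn0] := eqVneq t 0.
    have [->|yn0] := eqVneq y 0.
      rewrite powRr0 !add0r [0 `^ 1]powR0 ?oner_eq0//.
      rewrite /c; have [->|xn0] := eqVneq x 0; first by rewrite !powRr0; lra.
      by rewrite powR0// mulr0 addr0 mulr1 mulr_ge0 ?subr_ge0 ?powR_ge0.
    have {}yn0 : 0 < y by rewrite lt_def yn0 y0.
    by rewrite !powR0 ?mulr0 ?addr0 ?gt_eqF ?ltr_pwDl.
  rewrite !powRD; try by rewrite tn0 implybT.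
  rewrite powRr1//.
  have h := powR_bernoulli (divr_ge0 t0 (ltW y1)) x01.
  have -> : t `^ x = c * (t / (y + 1)) `^ x.
    rewrite -powRM; [|lra|by rewrite divr_ge0//; lra].
    by congr (_ `^ _); field; lra.
  have := powR_ge0 t y; have c0 : 0 <= c by exact: powR_ge0.
  have := ler_wpM2l c0 h => {}h ty0.
  have := ler_wpM2l ty0 h => {}h.
  apply: (le_trans h); rewrite le_eqVlt; apply/orP; left; apply/eqP.
  by field; lra.
Qed.

(** Only the part t >= A of the integral is kept, where t^x >= A^x. As A is
    arbitrary, Gamma (1 + x) grows faster than any geometric sequence. *)
Lemma Gamma1_ge (x A : R) : 0 <= x -> 0 <= A -> A `^ x * expR (- A) <= Gamma (1 + x).
Proof.
move=> x0 A0; rewrite Gamma1E//.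
have i1 := integrable_gamma_density x0.
have i0 := integrable_gamma_density (lexx (0:R)).
have sub : `[A, +oo[ `<=` `[0, +oo[ by apply: subset_itvr; rewrite bnd_simp.
have -> : A `^ x * expR (- A) = \int[mu]_(t in `[A, +oo[) (A `^ x * (t `^ 0 * expR (- t))).
  rewrite RintegralZl//; last exact: integrableS i0.
  by rewrite Rintegral_expRN.
apply: (@le_trans _ _ (\int[mu]_(t in `[A, +oo[) (t `^ x * expR (- t)))).
  apply: le_Rintegral => //.
  - by apply: integrable_EFinM => //; exact: integrableS i0.
  - exact: integrableS i1.
  - move=> t; rewrite /= in_itv/= andbT => tA.
    rewrite powRr0 mul1r ler_wpM2r ?expR_ge0//.
    by apply: ge0_ler_powR => //; rewrite nnegrE//; lra.
rewrite [leRHS]Rintegral_mkcond [leLHS]Rintegral_mkcond.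
apply: le_Rintegral => //.
- by rewrite -restrict_EFin; apply/integrable_restrict => //=; rewrite setTI;
  exact: integrableS i1.
- by rewrite -restrict_EFin; apply/integrable_restrict => //=; rewrite setTI.
- move=> t _; rewrite !patchE; case: ifPn => [|_]; first by rewrite inE => /sub/mem_set ->.
  by case: ifPn => // _; rewrite mulr_ge0 ?powR_ge0 ?expR_ge0.
Qed.

Lemma Gamma1_gt0 (x : R) : 0 <= x -> 0 < Gamma (1 + x).
Proof.
move=> x0; apply: lt_le_trans (Gamma1_ge x0 ler01).
by rewrite powR1 mul1r expR_gt0.
Qed.

End gamma_integral.

(** * Euler's limit formula *)

(** Euler's product, equal to Gamma (n + x) / (Gamma n * Gamma (1 + x)): the
    factor by which expectations of eigenfunctions grow between times 1 and n. *)
Definition euler_prod (R : realType) (x : R) (n : nat) : R :=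
  \prod_(1 <= k < n) (1 + x / k%:R).

Section euler_prod.
Variable R : realType.
Implicit Types (x : R) (n : nat).

Lemma euler_prod1 x : euler_prod x 1 = 1.
Proof. by rewrite /euler_prod big_geq. Qed.

Lemma euler_prodS x n : (0 < n)%N -> euler_prod x n.+1 = euler_prod x n * (1 + x / n%:R).
Proof. by move=> n0; rewrite /euler_prod big_nat_recr. Qed.

Lemma Gamma1_nat n : Gamma (1 + n%:R) = n`!%:R :> R.
Proof.
elim: n => [|n ih]; first by rewrite Gamma1_0 fact0.
by rewrite -natr1 Gamma1S// ih factS natrM natr1.
Qed.

Lemma euler_prod_Gamma x n : 0 <= x ->
  euler_prod x n.+1 = Gamma (1 + (n%:R + x)) / (n`!%:R * Gamma (1 + x)).
Proof.
move=> x0; have g0 := Gamma1_gt0 x0.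
elim: n => [|n ih].
  by rewrite euler_prod1 fact0 add0r mul1r divff// gt_eqF.
rewrite euler_prodS// ih -natr1 addrAC Gamma1S; last by rewrite addr_ge0.
rewrite factS natrM -natr1.
have f0 : n`!%:R != 0 :> R by rewrite pnatr_eq0 -lt0n fact_gt0.
have n0 : 0 <= n%:R :> R by [].
by field; rewrite f0 gt_eqF//=; apply/eqP; lra.
Qed.

Let harmonic0 (a : R) : 1 + a * n.+1%:R^-1 @[n --> \oo] --> (1 : R).
Proof.
rewrite -[X in _ --> X]addr0 -[X in _ + X](mulr0 a).
by apply: cvgD; [exact: cvg_cst|apply: cvgMr; exact: cvg_harmonic].
Qed.

(** Gautschi's bounds. For 0 <= x <= 1, [Gamma1D_le] bounds Gamma (1 + n + x)
    from above by n! (n + 1)^x; applied to the complementary exponent 1 - x, from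
    n + x up to n + 1, it also gives a lower bound of the same order. The
    functional equation then propagates the limit from x - 1 to x. *)
Lemma Gamma1_ratio_cvg x : 0 <= x ->
  Gamma (1 + (n%:R + x)) / (n`!%:R * n.+1%:R `^ x) @[n --> \oo] --> (1 : R).
Proof.
have base (y : R) : 0 <= y <= 1 ->
    Gamma (1 + (n%:R + y)) / (n`!%:R * n.+1%:R `^ y) @[n --> \oo] --> (1 : R).
  move=> y01; have /andP[y0 y1] := y01.
  apply: (@squeeze_cvgr _ _ _ _ (fun n => 1 + (- 1) * n.+1%:R^-1) (cst 1)); last 2 first.
  - exact: harmonic0.
  - exact: cvg_cst.
  - apply: nearW => n.
    have n0 : 0 <= n%:R :> R by [].
    have f0 : 0 < n`!%:R :> R by rewrite ltr0n fact_gt0.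
    have p0 : 0 < n.+1%:R `^ y :> R by rewrite powR_gt0.
    have q0 : 0 < n.+2%:R `^ y :> R by rewrite powR_gt0.
    have q1 : 0 < n.+2%:R `^ (1 - y) :> R by rewrite powR_gt0.
    apply/andP; split; last first.
      rewrite ler_pdivrMr ?mulr_gt0// mul1r mulrC -Gamma1_nat -natr1.
      exact: Gamma1D_le.
    rewrite ler_pdivlMr ?mulr_gt0//.
    (* the bound for the exponent 1 - y, from n + y to n + 1 *)
    have h1 : n.+1%:R * n`!%:R <= n.+2%:R `^ (1 - y) * Gamma (1 + (n%:R + y)).
      rewrite -natrM -factS -Gamma1_nat.
      rewrite (_ : n.+1%:R = (n%:R + y) + (1 - y)); last by rewrite -natr1; lra.
      have ny0 : 0 <= n%:R + y by lra.
      have y01' : 0 <= 1 - y <= 1 by lra.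
      apply: (le_trans (Gamma1D_le ny0 y01')).
      rewrite ler_wpM2r ?Gamma1_ge0//.
      apply: ge0_ler_powR; rewrite ?nnegrE//; [lra|lra|].
      by rewrite -natr1 -natr1; lra.
    have h2 : n.+1%:R `^ y <= n.+2%:R `^ y :> R.
      by apply: ge0_ler_powR; rewrite ?nnegrE// ler_nat.
    have h3 : n.+2%:R `^ y * n.+2%:R `^ (1 - y) = n.+2%:R :> R.
      by rewrite -powRD ?subrKC ?powRr1// oner_eq0.
    have h4 : 1 + -1 * n.+1%:R^-1 <= n.+1%:R / n.+2%:R :> R.
      rewrite -[n.+2%:R]natr1 -[n.+1%:R]natr1.
      rewrite -subr_ge0.
      have -> : (n%:R + 1) / (n%:R + 1 + 1) - (1 + -1 * (n%:R + 1)^-1)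
        = (n%:R + 1 + 1)^-1 / (n%:R + 1) :> R by field; apply/andP; split; apply/eqP; lra.
      by rewrite divr_ge0 ?invr_ge0//; lra.
    rewrite -(ler_pM2l q1).
    apply: le_trans h1.
    apply: (@le_trans _ _ (n.+2%:R `^ (1 - y) * (n.+1%:R / n.+2%:R * (n`!%:R * n.+2%:R
      `^ y)))).
      apply: ler_wpM2l; first exact: ltW.
      apply: (@le_trans _ _ (n.+1%:R / n.+2%:R * (n`!%:R * n.+1%:R `^ y))).
        by apply: ler_wpM2r => //; rewrite mulr_ge0// ltW.
      by apply: ler_wpM2l; rewrite ?divr_ge0// ler_wpM2l.
    rewrite le_eqVlt; apply/orP; left; apply/eqP.
    transitivity (n.+1%:R / n.+2%:R * n`!%:R * (n.+2%:R `^ y * n.+2%:R `^ (1 - y)) :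
      R); first by ring.
    by rewrite h3 mulrAC divfK// pnatr_eq0.
move=> x0; have [j] : exists j : nat, x <= j.+1%:R.
  exists (Num.truncn x); exact: ltW (truncnS_gt x).
elim: j x x0 => [|j ih] x x0 xj; first by apply: base; rewrite x0.
have [x1|x1] := leP x 1; first by apply: base; rewrite x0.
have {}ih := ih (x - 1).
have h : (1 + (x - 1) * n.+1%:R^-1) * (Gamma (1 + (n%:R + (x - 1))) / (n`!%:R * n.+1%:R
  `^ (x - 1)))
    @[n --> \oo] --> (1 : R).
  rewrite -[X in _ --> X]mulr1; apply: cvgM; first exact: harmonic0.
  by apply: ih; rewrite ?lerBlDr ?natr1//; lra.
apply: cvg_trans h; apply: near_eq_cvg; apply: nearW => n.
have n0 : 0 <= n%:R :> R by [].
have -> : n%:R + x = (n%:R + (x - 1)) + 1 by lra.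
rewrite Gamma1S; last by lra.
have -> : n.+1%:R `^ x = n.+1%:R `^ (x - 1) * n.+1%:R :> R.
  rewrite -[X in _ = _ * X](@powRr1 _ n.+1%:R)// -powRD ?subrK//.
  by rewrite pnatr_eq0 implybT.
have f0 : n`!%:R != 0 :> R by rewrite pnatr_eq0 -lt0n fact_gt0.
have p0 : n.+1%:R `^ (x - 1) != 0 :> R by rewrite gt_eqF ?powR_gt0.
move: p0; move: (n.+1%:R `^ (x - 1)) => pw p0; rewrite -natr1.
by field; rewrite f0 p0 ?andbT; apply/eqP; lra.
Qed.

Lemma euler_prod_cvg x : 0 <= x ->
  euler_prod x n / n%:R `^ x @[n --> \oo] --> (Gamma (1 + x))^-1.
Proof.
move=> x0; rewrite -cvg_shiftS/=.
have h : (Gamma (1 + (n%:R + x)) / (n`!%:R * n.+1%:R `^ x)) * (Gamma (1 + x))^-1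
    @[n --> \oo] --> (Gamma (1 + x))^-1.
  rewrite -[X in _ --> X]mul1r; apply: cvgM; last exact: cvg_cst.
  exact: Gamma1_ratio_cvg.
apply: cvg_trans h; apply: near_eq_cvg; apply: nearW => n /=.
by rewrite euler_prod_Gamma// !invfM -!mulrA; congr (_ * (_ * _)); rewrite mulrC.
Qed.

Lemma euler_prod_ge1 x n : 0 <= x -> 1 <= euler_prod x n.
Proof.
move=> x0; rewrite /euler_prod; elim/big_ind: _ => //.
  by move=> a b a1 b1; rewrite mulr_ege1.
by move=> k _; rewrite lerDl divr_ge0.
Qed.

Lemma euler_prod_gt0 x n : 0 <= x -> 0 < euler_prod x n.
Proof. by move=> /euler_prod_ge1 h; exact: lt_le_trans (h n). Qed.

(** The quotient of n^a by the product converges, hence is bounded. *)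
Lemma euler_prod_inv_le (a : R) : 0 <= a -> exists2 C : R, 0 < C &
  forall n, (0 < n)%N -> (euler_prod a n)^-1 <= C * (n%:R `^ a)^-1.
Proof.
move=> a0.
have h : (euler_prod a n / n%:R `^ a)^-1 @[n --> \oo] --> ((Gamma (1 + a))^-1)^-1.
  apply: cvgV; last exact: euler_prod_cvg.
  by rewrite invr_eq0 gt_eqF// Gamma1_gt0.
have /cvg_seq_bounded/pinfty_ex_gt0[M M_gt0 /= uM] : cvgn (fun n => (euler_prod a n /
  n%:R `^ a)^-1).
  by apply/cvg_ex; eexists; exact: h.
exists M => // n n0.
have r0 : 0 < euler_prod a n by exact: euler_prod_gt0.
have p0 : 0 < n%:R `^ a :> R by rewrite powR_gt0// ltr0n.
rewrite -(ler_pM2r p0) divfK ?gt_eqF//.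
apply: le_trans (uM n Logic.I).
by rewrite invfM invrK ger0_norm// mulr_ge0 ?invr_ge0// ltW.
Qed.

End euler_prod.

Lemma powR_cvgy (R : realType) (a : R) : 0 < a ->
  n%:R `^ a @[n --> \oo] --> +oo.
Proof.
move=> a0.
apply/cvgryPge => A; near=> n.
have An : (Num.max A 1) `^ a^-1 <= n%:R.
  by near: n; exact: nbhs_infty_ger.
have m0 : 0 <= Num.max A 1 by rewrite le_max ler01 orbT.
have : ((Num.max A 1) `^ a^-1) `^ a <= n%:R `^ a.
  by apply: ge0_ler_powR; rewrite ?nnegrE ?powR_ge0// ltW.
rewrite -powRrM mulVf ?gt_eqF// powRr1//.
by apply: le_trans; rewrite le_max lexx.
Unshelve. all: by end_near. Qed.

(** * The exponential series and the Mittag-Leffler series *)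

Lemma exp_partial_sum_le (R : realType) (x : R) n : 0 <= x ->
  \sum_(0 <= k < n) x ^+ k / k`!%:R <= expR x.
Proof.
move=> x0.
have h := @nondecreasing_cvgn_le _ (series (exp_coeff x)) _ (is_cvg_series_exp_coeff x) n.
by apply: h; apply/nondecreasing_seqP => m;
  rewrite /series/= big_nat_recr//= lerDl /exp_coeff divr_ge0 ?exprn_ge0.
Qed.

Lemma exp_partial_sum_cvg (R : realType) (x : R) :
  \sum_(0 <= k < n) x ^+ k / k`!%:R @[n --> \oo] --> expR x.
Proof. exact: (is_cvg_series_exp_coeff x). Qed.

(** [Gamma1_ge] with A^a = 2 t + 1 bounds the k-th term by exp A / 2^k. *)
Lemma Gamma_series_bounded (R : realType) (a t : R) : 0 < a -> 0 <= t ->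
  exists B : R, forall n, \sum_(0 <= k < n) t ^+ k / Gamma (1 + k%:R * a) <= B.
Proof.
move=> a0 t0; pose A := (2 * t + 1) `^ a^-1.
have A0 : 0 <= A by exact: powR_ge0.
have term k : t ^+ k / Gamma (1 + k%:R * a) <= expR A * (2^-1) ^+ k.
  have ka0 : 0 <= k%:R * a by rewrite mulr_ge0// ltW.
  have g0 := Gamma1_gt0 ka0.
  rewrite ler_pdivrMr//.
  apply: (@le_trans _ _ (expR A * 2^-1 ^+ k * (A `^ (k%:R * a) * expR (- A)))); last first.
    apply: ler_wpM2l; first by rewrite mulr_ge0 ?expR_ge0// exprn_ge0// invr_ge0.
    exact: Gamma1_ge.
  rewrite /A -powRrM [a^-1 * _]mulrCA mulVf ?gt_eqF// mulr1 -/A powR_mulrn; last by lra.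
  rewrite expRN.
  have -> : expR A * 2^-1 ^+ k * ((2 * t + 1) ^+ k / expR A) = (2^-1 * (2 * t + 1)) ^+ k.
    by rewrite exprMn; field; rewrite gt_eqF ?expR_gt0.
  by apply: lerXn2r; rewrite ?nnegrE; lra.
exists (expR A * 2) => n.
apply: (le_trans (ler_sum _ (fun k _ => term k))).
rewrite -mulr_sumr ler_pM2l ?expR_gt0//.
suff : \sum_(0 <= k < n) 2^-1 ^+ k = 2 - 2 * 2^-1 ^+ n :> R.
  by move=> ->; rewrite gerBl mulr_ge0// exprn_ge0.
elim: n => [|n ih]; first by rewrite big_geq// expr0; lra.
by rewrite big_nat_recr//= ih exprS; lra.
Qed.

(** * Expectations of bounded measurable functions *)

(** Bounded measurable functions are integrable and stable under products, so
    that computing with expectations of functions of finitely many steps raises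
    no integrability condition. *)
Definition bdd_mfun d (T : measurableType d) (R : realType) (f : T -> R) : Prop :=
  measurable_fun setT f /\ exists M, forall w, `|f w| <= M.

Section bounded_measurable.
Context d (T : measurableType d) (R : realType) (P : probability T R).
Implicit Types f g : T -> R.
Local Notation Ex f := (\int[P]_w (f w)).

Lemma bdd_mfun_cst (c : R) : bdd_mfun (fun _ : T => c).
Proof. by split; [exact: measurable_cst|exists `|c|]. Qed.

Lemma bdd_mfunD f g : bdd_mfun f -> bdd_mfun g -> bdd_mfun (fun w => f w + g w).
Proof.
move=> [mf [M fM]] [mg [N gN]]; split; first exact: measurable_funD.
by exists (M + N) => w; rewrite (le_trans (ler_normD _ _))// lerD.
Qed.

Lemma bdd_mfunM f g : bdd_mfun f -> bdd_mfun g -> bdd_mfun (fun w => f w * g w).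
Proof.
move=> [mf [M fM]] [mg [N gN]]; split; first exact: measurable_funM.
by exists (M * N) => w; rewrite normrM ler_pM.
Qed.

Lemma bdd_mfunZ (c : R) f : bdd_mfun f -> bdd_mfun (fun w => c * f w).
Proof. by move=> bf; apply: bdd_mfunM => //; exact: bdd_mfun_cst. Qed.

Lemma bdd_mfunB f g : bdd_mfun f -> bdd_mfun g -> bdd_mfun (fun w => f w - g w).
Proof.
move=> bf bg; apply: bdd_mfunD => //.
by under eq_fun do rewrite -mulN1r; exact: bdd_mfunZ.
Qed.

Lemma bdd_mfun_sum (I : Type) (s : seq I) (h : I -> T -> R) :
  (forall i, bdd_mfun (h i)) -> bdd_mfun (fun w => \sum_(i <- s) h i w).
Proof.
move=> bh; elim: s => [|i s ih].
  by under eq_fun do rewrite big_nil; exact: bdd_mfun_cst.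
by under eq_fun do rewrite big_cons; exact: bdd_mfunD.
Qed.

Lemma bdd_mfunX f n : bdd_mfun f -> bdd_mfun (fun w => f w ^+ n).
Proof.
move=> bf; elim: n => [|n ih].
  by under eq_fun do rewrite expr0; exact: bdd_mfun_cst.
by under eq_fun do rewrite exprS; exact: bdd_mfunM.
Qed.

Lemma bdd_mfun_indic (A : set T) : measurable A -> bdd_mfun (\1_A : T -> R).
Proof.
move=> mA; split; first exact: measurable_indic.
by exists 1 => w; rewrite indicE ger0_norm// lern1; case: (_ \in _).
Qed.

Lemma bdd_mfun_integrable f : bdd_mfun f -> P.-integrable setT (EFin \o f).
Proof.
move=> [mf [M fM]]; apply: measurable_bounded_integrable => //.
  by apply: le_lt_trans (probability_le1 P measurableT) _; rewrite ltry.
exists M; split; first by rewrite num_real.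
by move=> x Mx w _; exact: le_trans (fM w) (ltW Mx).
Qed.

Lemma ExD f g : bdd_mfun f -> bdd_mfun g -> Ex (fun w => f w + g w) = Ex f + Ex g.
Proof. by move=> bf bg; rewrite RintegralD//; exact: bdd_mfun_integrable. Qed.

Lemma ExB f g : bdd_mfun f -> bdd_mfun g -> Ex (fun w => f w - g w) = Ex f - Ex g.
Proof. by move=> bf bg; rewrite RintegralB//; exact: bdd_mfun_integrable. Qed.

Lemma ExZ c f : bdd_mfun f -> Ex (fun w => c * f w) = c * Ex f.
Proof. by move=> bf; rewrite RintegralZl//; exact: bdd_mfun_integrable. Qed.

Lemma Ex_cst (c : R) : Ex (fun=> c) = c.
Proof.
have := Rintegral_cst P measurableT c; rewrite /cst => ->.
by rewrite (_ : fine _ = 1) ?mulr1// -[RHS]/(fine 1%E); congr fine; exact: probability_setT.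
Qed.

Lemma Ex_sum (I : Type) (s : seq I) (h : I -> T -> R) : (forall i, bdd_mfun (h i)) ->
  Ex (fun w => \sum_(i <- s) h i w) = \sum_(i <- s) Ex (h i).
Proof.
move=> bh; elim: s => [|i s ih].
  by under eq_Rintegral do rewrite big_nil; rewrite big_nil Ex_cst.
under eq_Rintegral do rewrite big_cons.
by rewrite ExD ?ih ?big_cons//; exact: bdd_mfun_sum.
Qed.

Lemma Ex_indic (A : set T) : measurable A -> Ex (\1_A) = fine (P A).
Proof. by move=> mA; rewrite /Rintegral integral_indic// setIT. Qed.

Lemma Ex_le f g : bdd_mfun f -> bdd_mfun g -> (forall w, f w <= g w) -> Ex f <= Ex g.
Proof. by move=> bf bg fg; apply: le_Rintegral => //; exact: bdd_mfun_integrable. Qed.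

Lemma Ex_ae_eq f g : measurable_fun setT f -> measurable_fun setT g ->
  {ae P, forall w, f w = g w} -> Ex f = Ex g.
Proof.
move=> mf mg fg; rewrite /Rintegral; congr fine; apply: ae_eq_integral => //.
- exact/measurable_EFinP.
- exact/measurable_EFinP.
- by apply: filterS fg => w -> _.
Qed.

Lemma Ex_eq0 f : bdd_mfun f -> (forall w, 0 <= f w) -> Ex f = 0 ->
  {ae P, forall w, f w = 0}.
Proof.
move=> bf f0 Ef.
have : (\int[P]_w `|(EFin \o f) w| = 0)%E.
  under eq_integral do rewrite /= ger0_norm//.
  rewrite -[LHS]fineK ?[fine _]Ef//.
  by apply: integrable_fin_num => //; exact: bdd_mfun_integrable.
move/ae_eq_integral_abs => /(_ measurableT).
have mf : measurable_fun setT (EFin \o f) by apply/measurable_EFinP; exact: bf.1.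
move/(_ mf).
by apply: filterS => w /(_ Logic.I) /= [].
Qed.

End bounded_measurable.

(** * Limits of expectations and L^m norms *)

Section limits_of_expectations.
Context d (T : measurableType d) (R : realType) (P : probability T R).
Local Notation Ex f := (\int[P]_w (f w)).

(** Fatou's lemma in the form that carries a uniform bound to an almost sure
    limit. The limit is extended real because it is infinite on part of the space
    in the proof of positivity. *)
Lemma fatou_le (U : nat -> T -> R) (V : T -> \bar R) (B : R) :
  (forall n, measurable_fun setT (U n)) -> (forall n w, 0 <= U n w) ->
  measurable_fun setT V ->
  {ae P, forall w, (U n w)%:E @[n --> \oo] --> V w} ->
  (forall n, (\int[P]_w (U n w)%:E <= B%:E)%E) ->
  (\int[P]_w V w <= B%:E)%E.
Proof.
move=> mU U0 mV UV UB.
have mUE n : measurable_fun setT (fun w => (U n w)%:E) by exact/measurable_EFinP.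
have U0E n w : setT w -> (0 <= (U n w)%:E)%E by rewrite lee_fin.
rewrite (@ae_eq_integral _ _ _ P setT (fun w => limn_einf (fun n => (U n w)%:E)))//.
- apply: (le_trans (fatou P measurableT mUE U0E)).
  rewrite limn_einf_lim; apply: lime_le; first exact: is_cvg_einfs.
  apply: nearW => n; apply: le_trans (UB n).
  by apply: ereal_inf_lbound; exists n => //=.
- rewrite /limn_einf; apply: measurableT_comp => //.
  by apply: measurable_fun_limn_esup => n; apply: measurableT_comp.
- apply: filterS UV => w UVw _.
  rewrite is_cvg_limn_einfE; last by apply/cvg_ex; eexists; exact: UVw.
  by apply/esym/cvg_lim.
Qed.

(** Bounded second moments imply uniform integrability: for every C > 0, Z is at
    most min (Z, C) + Z^2 / C, where the first term is treated by dominated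
    convergence and the second has expectation at most B / C. *)
Lemma Ex_cvg0 (Z : nat -> T -> R) (B : R) :
  (forall n, measurable_fun setT (Z n)) -> (forall n w, 0 <= Z n w) ->
  {ae P, forall w, Z n w @[n --> \oo] --> (0 : R)} ->
  (forall n, P.-integrable setT (EFin \o Z n)) ->
  (forall n, P.-integrable setT (EFin \o (fun w => Z n w ^+ 2))) ->
  (forall n, Ex (fun w => Z n w ^+ 2) <= B) ->
  Ex (Z n) @[n --> \oo] --> (0 : R).
Proof.
move=> mZ Z0 Zae iZ iZ2 Z2B.
have B0 : 0 <= B.
  by apply: le_trans (Z2B 0%N); apply: Rintegral_ge0 => w _; exact: sqr_ge0.
have trunc C : 0 < C -> Ex (fun w => Num.min (Z n w) C) @[n --> \oo] --> (0 : R).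
  move=> C0.
  have mm n : measurable_fun setT (fun w => Num.min (Z n w) C).
    by apply: measurable_minr => //; exact: measurable_cst.
  have bC : P.-integrable setT (fun _ : T => C%:E).
    by have := bdd_mfun_integrable P (bdd_mfun_cst T C).
  have [| | | | |_ _] := @dominated_convergence _ _ _ P setT measurableT
    (fun n w => (Num.min (Z n w) C)%:E) (cst 0%E) (fun=> C%:E).
  - by move=> n; exact/measurable_EFinP.
  - exact: measurable_cst.
  - apply: filterS Zae => w Zw _; apply: cvg_EFin; first exact: nearW.
    rewrite (_ : fine \o _ = (fun n => Num.min (Z n w) C))//.
    apply: (@squeeze_cvgr _ _ _ _ (cst 0) (fun n => Z n w)) => //; last exact: cvg_cst.
    by apply: nearW => n; rewrite le_min Z0 (ltW C0) ge_min lexx.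
  - exact: bC.
  - apply: aeW => w n _; rewrite lee_fin ger0_norm; first by rewrite ge_min lexx orbT.
    by rewrite le_min Z0 ltW.
  by rewrite integral_cst// mul0e => /fine_cvg.
apply/cvgrPdist_le => e e0.
(* makes B / C at most e / 2; B + 1 avoids a division by zero *)
pose C := 2 * (B + 1) / e.
have C0 : 0 < C by rewrite divr_gt0//; lra.
near=> n.
rewrite sub0r normrN ger0_norm; last by apply: Rintegral_ge0.
have bm : bdd_mfun (fun w => Num.min (Z n w) C).
  split; first by apply: measurable_minr => //; exact: measurable_cst.
  exists C => w; rewrite ger0_norm; first by rewrite ge_min lexx orbT.
  by rewrite le_min Z0 ltW.
apply: (@le_trans _ _ (Ex (fun w => Num.min (Z n w) C + C^-1 * Z n w ^+ 2))).
  apply: le_Rintegral => //.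
    apply: integrable_EFinD => //; first exact: bdd_mfun_integrable.
    exact: integrable_EFinM.
  move=> w _; have [zC|Cz] := leP (Z n w) C.
    by rewrite lerDl mulr_ge0 ?sqr_ge0// invr_ge0 ltW.
  apply: (@le_trans _ _ (C^-1 * Z n w ^+ 2)); last by rewrite lerDr ltW.
  by rewrite expr2 mulrA ler_peMl// mulrC ler_pdivlMr// mul1r ltW.
rewrite RintegralD//; [|exact: bdd_mfun_integrable|exact: integrable_EFinM].
rewrite RintegralZl//.
have h1 : C^-1 * Ex (fun w => Z n w ^+ 2) <= e / 2.
  apply: (@le_trans _ _ (C^-1 * B)); first by apply: ler_wpM2l => //; rewrite invr_ge0 ltW.
  rewrite /C invf_div -mulrA ler_pM2l// invfM -mulrA ler_piMr ?invr_ge0//.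
  by rewrite mulrC ler_pdivrMr; lra.
have h2 : Ex (fun w => Num.min (Z n w) C) <= e / 2.
  near: n; have e2 : 0 < e / 2 by lra.
  have /cvgrPdist_le/(_ _ e2) := trunc C C0.
  apply: filterS => n; rewrite sub0r normrN; apply: le_trans; exact: ler_norm.
by lra.
Unshelve. all: end_near. Qed.

(** By monotone convergence the sum of the series has expectation at most M, so it
    is finite almost everywhere. *)
Lemma ae_cvg_series (D : nat -> T -> R) (M : R) :
  (forall k, bdd_mfun (D k)) -> (forall k w, 0 <= D k w) ->
  (forall n, \sum_(0 <= k < n) Ex (D k) <= M) ->
  {ae P, forall w, cvgn (series (fun k => D k w))}.
Proof.
move=> bD D0 DM.
pose f w := (\sum_(0 <= k <oo) (D k w)%:E)%E.
have mD k : measurable_fun setT (fun w => (D k w)%:E).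
  by apply/measurable_EFinP; have [] := bD k.
have f0 w : (0 <= f w)%E by apply: nneseries_ge0 => k _ _; rewrite lee_fin.
have If : (\int[P]_w f w <= M%:E)%E.
  rewrite integral_nneseries//; last by move=> n w _; rewrite lee_fin.
  apply: lime_le.
    by apply: is_cvg_nneseries => k _ _; apply: integral_ge0 => w _; rewrite lee_fin.
  apply: nearW => n.
  rewrite (eq_bigr (fun k => (Ex (D k))%:E)); first by rewrite sumEFin lee_fin.
  move=> k _; rewrite /Rintegral fineK//.
  by apply: integrable_fin_num => //; exact: bdd_mfun_integrable.
have fi : P.-integrable setT f.
  apply/integrableP; split; first by apply: (@ge0_emeasurable_sum _ _ _ _ (fun k w =>
    (D k w)%:E) xpredT) => // k w _ _; rewrite lee_fin.
  under eq_integral do rewrite gee0_abs//.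
  exact: le_lt_trans If (ltry _).
apply: filterS (integrable_ae measurableT fi) => w /(_ Logic.I) ffin.
apply: nondecreasing_is_cvgn.
  by apply/nondecreasing_seqP => n; rewrite /series/= big_nat_recr//= lerDl.
exists (fine (f w)) => _ [n _ <-] /=.
rewrite -lee_fin fineK// -sumEFin.
by apply: nneseries_lim_ge => k _ _; rewrite lee_fin.
Qed.

Lemma integrable_ae_eq (f g : T -> R) : measurable_fun setT g ->
  {ae P, forall w, f w = g w} -> P.-integrable setT (EFin \o f) ->
  P.-integrable setT (EFin \o g).
Proof.
move=> mg fg /integrableP[mf fi]; apply/integrableP; split; first exact/measurable_EFinP.
rewrite (@ge0_ae_eq_integral _ _ _ P setT _ (fun w => `|(EFin \o f) w|%E))//.
- by apply: measurableT_comp => //; exact/measurable_EFinP.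
- exact: measurableT_comp.
- by apply: filterS fg => w /= -> _.
Qed.

Lemma Lnorm_natE m (f : T -> R) : (0 < m)%N ->
  P.-integrable setT (EFin \o (fun w => `|f w| ^+ m)) ->
  'N[P]_((m%:R)%:E)[EFin \o f]%E = ((Ex (fun w => `|f w| ^+ m)) `^ (m%:R^-1))%:E.
Proof.
move=> m0 fi; rewrite unlock -poweR_EFin; congr (_ `^ _)%E.
rewrite /Rintegral fineK; last exact: integrable_fin_num.
by apply: eq_integral => w _ /=; rewrite powR_mulrn.
Qed.

Lemma Lfun_nat m (f : T -> R) : (0 < m)%N -> measurable_fun setT f ->
  P.-integrable setT (EFin \o (fun w => `|f w| ^+ m)) ->
  f \in Lfun P (m%:R)%:E.
Proof.
move=> m0 mf fi; rewrite inE; apply/andP; split; rewrite inE//=.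
by rewrite /finite_norm Lnorm_natE// ltry.
Qed.

Lemma Lnorm_nat_cvg0 m (f : nat -> T -> R) : (0 < m)%N ->
  (forall n, P.-integrable setT (EFin \o (fun w => `|f n w| ^+ m))) ->
  Ex (fun w => `|f n w| ^+ m) @[n --> \oo] --> (0 : R) ->
  ('N[P]_((m%:R)%:E)[EFin \o f n] @[n --> \oo] --> 0)%E.
Proof.
move=> m0 fi f0.
rewrite (_ : (fun n => _) = (fun n => ((Ex (fun w => `|f n w| ^+ m)) `^
  (m%:R^-1))%:E)); last first.
  by apply/funext => n; rewrite Lnorm_natE.
apply: cvg_EFin; first exact: nearW.
apply/cvgrPdist_le => e e0.
have em0 : 0 < e ^+ m by rewrite exprn_gt0.
move/cvgrPdist_le/(_ _ em0) : f0; apply: filterS => n /=.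
have E0 : 0 <= Ex (fun w => `|f n w| ^+ m).
  by apply: Rintegral_ge0 => w _; rewrite exprn_ge0.
rewrite !sub0r !normrN (ger0_norm E0) ger0_norm ?powR_ge0// => h.
have -> : e = (e ^+ m) `^ m%:R^-1.
  by rewrite -powR_mulrn ?ltW// -powRrM mulfV ?powRr1 ?ltW// pnatr_eq0 -lt0n.
by apply: ge0_ler_powR; rewrite ?nnegrE ?invr_ge0// ltW.
Qed.

End limits_of_expectations.

(** * Convergence along powers of the integers *)

(** For n > 0, the index i of the block from (i + 1)^L to (i + 2)^L that contains
    n. *)
Definition floor_root (L n : nat) : nat := (\max_(i < n | i.+1 ^ L <= n) i)%N.

Lemma floor_rootP L n : (0 < L)%N -> (0 < n)%N ->
  ((floor_root L n).+1 ^ L <= n < (floor_root L n).+2 ^ L)%N.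
Proof.
move=> L0 n0; apply/andP; split.
  have [|i iP iE] := @eq_bigmax_cond 'I_n (fun i : 'I_n => (i.+1 ^ L <= n)%N) (fun i =>
    nat_of_ord i).
    by apply/card_gt0P; exists (Ordinal n0); rewrite unfold_in /= exp1n.
  by rewrite (_ : floor_root L n = i); [exact: iP|exact: iE].
rewrite ltnNge; apply/negP => h.
have kn : ((floor_root L n).+1 < n)%N.
  by apply: leq_trans h; rewrite -[X in (X <= _)%N]expn1 leq_exp2l.
have := @leq_bigmax_cond 'I_n (fun i : 'I_n => (i.+1 ^ L <= n)%N) (fun i => nat_of_ord
  i) (Ordinal kn) h.
by rewrite -/(floor_root L n) /= ltnn.
Qed.

Lemma floor_root_cvg L : (0 < L)%N -> floor_root L n @[n --> \oo] --> \oo.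
Proof.
move=> L0; apply/cvgnyPge => m; near=> n.
have mn : (m.+1 ^ L <= n)%N by near: n; exact: nbhs_infty_ge.
have mn' : (m < n)%N.
  by apply: leq_trans mn; rewrite -[X in (X <= _)%N]expn1 leq_pexp2l.
exact: (@leq_bigmax_cond 'I_n (fun i : 'I_n => (i.+1 ^ L <= n)%N) (fun i => nat_of_ord
  i) (Ordinal mn') mn).
Unshelve. all: by end_near. Qed.

Section subsequence.
Variable R : realType.

Lemma ratio_pow_cvg L (a : R) : 0 <= a <= 1 ->
  ((k.+2 ^ L)%:R / (k.+1 ^ L)%:R) `^ a @[k --> \oo] --> (1 : R).
Proof.
move=> /andP[a0 a1].
apply: (@squeeze_cvgr _ _ _ _ (cst 1) (fun k => (1 + k.+1%:R^-1) ^+ L)).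
- apply: nearW => k.
  have -> : (k.+2 ^ L)%:R / (k.+1 ^ L)%:R = (1 + k.+1%:R^-1) ^+ L :> R.
    rewrite !natrX -expr_div_n; congr (_ ^+ _).
    by rewrite -natr1 mulrDl divff ?mul1r// pnatr_eq0.
  have h : 1 <= (1 + k.+1%:R^-1) ^+ L :> R.
    by rewrite exprn_ege1// lerDl invr_ge0.
  by rewrite ler1_powR// andbT -[leLHS](powRr0 ((1 + k.+1%:R^-1) ^+ L)) ler_powR.
- exact: cvg_cst.
- have h1 : 1 + k.+1%:R^-1 @[k --> \oo] --> (1 : R).
    by rewrite -[X in _ --> X]addr0; apply: cvgD; [exact: cvg_cst|exact: cvg_harmonic].
  elim: L => [|L ih]; first by under eq_cvg do rewrite expr0; exact: cvg_cst.
  rewrite (_ : (fun k => _) = (fun k => (1 + k.+1%:R^-1) * (1 + k.+1%:R^-1) ^+ L));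
    last first.
    by apply/funext => k; rewrite exprS.
  by rewrite -[X in _ --> X]mulr1; exact: cvgM.
Qed.

(** For n in the block from N_k to N_(k+1), monotonicity puts u n / n^a between
    the values at the two ends of the block, up to the factor (N_(k+1) / N_k)^a,
    which tends to 1. *)
Lemma cvg_subseq_powers (u : nat -> R) (L : nat) (a l : R) :
  (0 < L)%N -> 0 <= a <= 1 -> (forall n, 0 <= u n) -> nondecreasing_seq u ->
  u (k.+1 ^ L)%N / (k.+1 ^ L)%:R `^ a @[k --> \oo] --> l ->
  u n / n%:R `^ a @[n --> \oo] --> l.
Proof.
move=> L0 a01 u0 ndu ul; have /andP[a0 a1] := a01.
pose N k := (k.+1 ^ L)%N.
have N0 k : 0 < (N k)%:R :> R by rewrite ltr0n expn_gt0.
pose c k : R := ((N k.+1)%:R / (N k)%:R) `^ a.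
have c1 : c k @[k --> \oo] --> (1 : R) by exact: ratio_pow_cvg.
have c0 k : 0 < c k by rewrite powR_gt0// divr_gt0.
have NS k : (N k.+1)%:R `^ a = c k * (N k)%:R `^ a.
  by rewrite /c -powRM ?divfK ?gt_eqF// divr_ge0.
have fl := floor_root_cvg L0.
apply: (@squeeze_cvgr _ _ _ _
  (fun n => (u (N (floor_root L n)) / (N (floor_root L n))%:R `^ a) * (c (floor_root L
    n))^-1)
  (fun n => (u (N (floor_root L n).+1) / (N (floor_root L n).+1)%:R `^ a) * c
    (floor_root L n))).
- near=> n.
  have n0 : (0 < n)%N by near: n; exact: nbhs_infty_gt.
  have /andP[kn nk] := floor_rootP L0 n0.
  set k := floor_root L n in kn nk *.
  have pN j : 0 < (N j)%:R `^ a by rewrite powR_gt0.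
  have pn : 0 < n%:R `^ a :> R by rewrite powR_gt0// ltr0n.
  have k1 : (N k)%:R `^ a <= n%:R `^ a :> R.
    by apply: ge0_ler_powR; rewrite ?nnegrE// ler_nat.
  have k2 : n%:R `^ a <= (N k.+1)%:R `^ a :> R.
    by apply: ge0_ler_powR; rewrite ?nnegrE// ler_nat ltnW.
  apply/andP; split.
    rewrite -mulrA -invfM [_ * c k]mulrC -NS.
    by apply: ler_pM; rewrite ?invr_ge0 ?u0 ?ndu ?lef_pV2 ?posrE ?powR_ge0 ?(ltW nk).
  rewrite NS invfM mulrA mulrAC divfK ?gt_eqF//.
  have u2 : u n <= u (N k.+1) by apply: ndu; exact: ltnW.
  by apply: ler_pM; rewrite ?invr_ge0 ?u0 ?lef_pV2 ?posrE ?powR_ge0.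
- rewrite -[X in _ --> X]mulr1; apply: cvgM; first exact: (cvg_comp _ _ fl ul).
  rewrite -[X in _ --> X]invr1; apply: cvgV; first by rewrite oner_eq0.
  exact: (cvg_comp _ _ fl c1).
- rewrite -[X in _ --> X]mulr1; apply: cvgM; last exact: (cvg_comp _ _ fl c1).
  have ulS : u (N k.+1) / (N k.+1)%:R `^ a @[k --> \oo] --> l.
    by have := ul; rewrite -[X in X -> _]cvg_shiftS.
  exact: (cvg_comp _ _ fl ulS).
Unshelve. all: by end_near. Qed.

(** Telescoping, from 1 / (n + 1)^2 <= 1 / n - 1 / (n + 1). At n = 0 the bound
    is 2, because the inverse of 0 is 0. *)
Lemma sum_inv_sqr_le n : \sum_(0 <= k < n) k.+1%:R ^- 2 <= 2 - n%:R^-1 :> R.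
Proof.
elim: n => [|[|n] ih]; first by rewrite big_geq// invr0 subr0.
  by rewrite big_nat1 expr1n invr1; lra.
rewrite big_nat_recr//=.
apply: (le_trans (lerD ih (lexx _))).
rewrite -[n.+2%:R]natr1; have : 0 < n.+1%:R :> R by rewrite ltr0n.
move: (n.+1%:R : R) => x x0.
rewrite -subr_ge0.
have -> : 2 - (x + 1)^-1 - (2 - x^-1 + (x + 1) ^- 2) = (x * (x + 1) ^+ 2)^-1.
  by field; apply/andP; split; apply/eqP; lra.
by rewrite invr_ge0 mulr_ge0 ?sqr_ge0// ltW.
Qed.

End subsequence.

(** * The conditional law of the next step *)

Lemma sum_pick (I : eqType) (R : pzRingType) (s : seq I) (F : I -> R) (i : I) :
  uniq s ->
  \sum_(k <- s) F k * (i == k)%:R = if i \in s then F i else 0.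
Proof.
move=> us; case: ifPn => si.
  rewrite (bigD1_seq i)//= eqxx mulr1 big1 ?addr0// => k ki.
  by rewrite eq_sym (negPf ki) mulr0.
rewrite big_seq big1// => k ks; case: eqP => [ik|_]; last by rewrite mulr0.
by rewrite ik ks in si.
Qed.

(** The values of the steps as well as those of the signs: the list is closed
    under products, which is why the steps never leave it. *)
Definition signs (R : realType) : seq R := [:: 1; -1; 0].

Lemma uniq_signs (R : realType) : uniq (signs R).
Proof.
rewrite /= !inE !negb_or oner_eq0 oppr_eq0 oner_eq0 !andbT.
by apply/eqP; lra.
Qed.

Lemma sum_signs_pmf (R : realType) (p q r : R) (F : R -> R) :
  \sum_(e <- signs R) F e * sign_pmf p q r e = F 1 * p + F (-1) * q + F 0 * r.
Proof.
rewrite !big_cons big_nil /sign_pmf !eqxx !(eq_sym 0) oppr_eq0 oner_eq0.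
have -> : (1 == -1 :> R) = false by apply/eqP; lra.
have -> : (-1 == 1 :> R) = false by apply/eqP; lra.
by rewrite !mulr0n !mulr1n; ring.
Qed.

(** The atoms of the past, on which the definition of the walk prescribes
    probabilities. *)
Definition past d (T : measurableType d) (R : realType) (X : nat -> T -> R)
    (n : nat) (x : nat -> R) : set T :=
  [set w | forall i, (1 <= i <= n)%N -> X i w = x i].

(** For steps with finitely many values this is measurability with respect to the
    first n steps; the form below makes psi constant on each atom at once. *)
Definition depends_on_past d (T : measurableType d) (R : realType)
    (X : nat -> T -> R) (n : nat) (psi : T -> R) : Prop :=
  forall w w', (forall i, (1 <= i <= n)%N -> X i w = X i w') -> psi w = psi w'.

Definition nb_ones d (T : measurableType d) (R : realType) (X : nat -> T -> R)
    (n : nat) (w : T) : nat := (\sum_(1 <= k < n.+1) (X k w != 0)%R)%N.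

(** All that the sequel uses of the walk. Testing against every bounded psi that
    depends on the past says that the conditional probability of a nonzero step
    at time n + 1 is a * nb_ones X n / n. *)
Definition ones_chain d (T : measurableType d) (R : realType)
    (P : probability T R) (X : nat -> T -> R) (a : R) : Prop :=
  {ae P, forall w, nb_ones X 1 w = 1%N} /\
  forall n (psi : T -> R), (0 < n)%N -> bdd_mfun psi -> depends_on_past X n psi ->
  \int[P]_w (psi w * (X n.+1 w != 0)%:R) =
  a / n%:R * \int[P]_w (psi w * (nb_ones X n w)%:R).

Section steps.
Context d (T : measurableType d) (R : realType) (P : probability T R).
Variable X : nat -> {RV P >-> R}.
Local Notation Ex f := (\int[P]_w (f w)).

Lemma measurable_eq (Y : {RV P >-> R}) v : measurable [set w | Y w = v].
Proof. exact: (measurable_funPTI Y (measurable_set1 v)). Qed.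

Lemma measurable_eqn (Y : {RV P >-> nat}) v : measurable [set w | Y w = v].
Proof. by have := @measurable_funPTI _ _ _ _ Y [set v]; apply. Qed.

Lemma past0 x : past X 0 x = setT.
Proof.
by apply/seteqP; split => // w _ i /andP[i1 i0]; rewrite leqn0 in i0;
  rewrite (eqP i0) in i1.
Qed.

Lemma pastS n x : past X n.+1 x = past X n x `&` [set w | X n.+1 w = x n.+1].
Proof.
apply/seteqP; split => w /=.
  move=> h; split; last by apply: h; rewrite leqnn.
  by move=> i /andP[i1 i_n]; apply: h; rewrite i1 leqW.
move=> [h hS] i /andP[i1]; rewrite leq_eqVlt => /predU1P[->//|i_n].
by apply: h; rewrite i1.
Qed.

Lemma measurable_past n x : measurable (past X n x).
Proof.
elim: n => [|n ih]; first by rewrite past0.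
by rewrite pastS; apply: measurableI => //; exact: measurable_eq.
Qed.

Lemma pastS_upd n x v w :
  (w \in past X n.+1 (fun i => if i == n.+1 then v else x i)) =
  (w \in past X n x) && (X n.+1 w == v).
Proof.
rewrite pastS eqxx in_setI; congr (_ && _); last first.
  by apply/idP/eqP => [|h]; rewrite inE.
apply/idP/idP; rewrite !inE => h i i1n; have /andP[_ i_n] := i1n.
  by rewrite h// ltn_eqF// ltnS.
by rewrite h// ltn_eqF// ltnS.
Qed.

Lemma bdd_mfun_ones n : bdd_mfun (fun w => (X n w != 0)%:R : R).
Proof.
have h := bdd_mfun_indic R (measurableC (measurable_eq (X n) 0)).
rewrite (_ : (fun w => _) = \1_(~` [set w | X n w = 0]))//.
apply/funext => w; rewrite indicE; congr (_%:R); congr nat_of_bool.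
by rewrite in_setC; congr (~~ _); apply/eqP/idP; rewrite inE.
Qed.

Lemma nb_onesS n w : nb_ones X n.+1 w = (nb_ones X n w + (X n.+1 w != 0)%R)%N.
Proof. by rewrite /nb_ones big_nat_recr. Qed.

(** The induction is for all phi at once: at time n + 1 the value is that of phi,
    or of its shift, at the previous number of ones. *)
Lemma bdd_mfun_nb_ones (phi : nat -> R) n : bdd_mfun (fun w => phi (nb_ones X n w)).
Proof.
elim: n phi => [|n ih] phi.
  by under eq_fun do rewrite /nb_ones big_geq//; exact: bdd_mfun_cst.
rewrite (_ : (fun w => _) = (fun w => phi (nb_ones X n w) +
   (X n.+1 w != 0)%:R * (phi (nb_ones X n w).+1 - phi (nb_ones X n w)))).
  apply: bdd_mfunD => //; apply: bdd_mfunM; first exact: bdd_mfun_ones.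
  by apply: bdd_mfunB => //; exact: (ih (fun j => phi j.+1)).
apply/funext => w; rewrite nb_onesS; case: (X n.+1 w != 0).
  by rewrite addn1 mul1r subrKC.
by rewrite addn0 mul0r addr0.
Qed.

Definition signs_upto n := {ae P, forall w, forall i, (1 <= i <= n)%N -> X i w \in signs R}.

(** An expectation is the sum of its parts on the atoms of the past. Instead of
    summing over all paths of length n, drop the last coordinate of x step by
    step: up to a negligible set, an atom of length m is the disjoint union of
    three atoms of length m + 1. *)
Lemma Ex_past_eq0 n (u : T -> R) : signs_upto n -> bdd_mfun u ->
  (forall x, Ex (fun w => u w * \1_(past X n x) w) = 0) -> Ex u = 0.
Proof.
move=> sX bu u0.
suff H j x : (j <= n)%N -> Ex (fun w => u w * \1_(past X (n - j) x) w) = 0.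
  rewrite -[RHS](H n (fun=> 0))// subnn past0.
  by apply: eq_Rintegral => w _; rewrite indicT mulr1.
elim: j x => [|j ih] x jn; first by rewrite subn0.
have nj : (n - j = (n - j.+1).+1)%N by rewrite subnSK.
set m := (n - j.+1)%N in nj *.
have bu' y k : bdd_mfun (fun w => u w * \1_(past X k y) w).
  by apply: bdd_mfunM => //; apply: bdd_mfun_indic; exact: measurable_past.
rewrite (@Ex_ae_eq _ _ _ _ _ (fun w => \sum_(v <- signs R)
   u w * \1_(past X m.+1 (fun i => if i == m.+1 then v else x i)) w)).
- by rewrite Ex_sum// big1// => v _; rewrite -nj ih// ltnW.
- by have [] := bu' x m.
- by have [] := @bdd_mfun_sum _ _ _ _ (signs R) _
    (fun v => bu' (fun i => if i == m.+1 then v else x i) m.+1).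
- apply: filterS sX => w /(_ m.+1) sw.
  under eq_bigr do rewrite indicE pastS_upd -mulnb natrM mulrA.
  by rewrite sum_pick ?uniq_signs// sw//= -?nj ?leq_subr// indicE.
Qed.

Section one_step.
Variables (p q r : R) (n : nat) (K : {RV P >-> nat}) (E : {RV P >-> R}).
Hypothesis pqr : p + q + r = 1.
Hypothesis n0 : (0 < n)%N.
Hypothesis XKE : {ae P, forall w, X n.+1 w = E w * X (K w) w}.
Hypothesis law : forall (x : nat -> R) (k : nat) (e : R), (1 <= k <= n)%N ->
  P (past X n x `&` [set w | K w = k] `&` [set w | E w = e]) =
  (P (past X n x) * (n%:R^-1)%:E * (sign_pmf p q r e)%:E)%E.
Hypothesis sX : signs_upto n.

(** G c expands c (K, E) over the admissible values of the remembered time K and of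
    the sign E, since the law of the walk gives the probability of each pair of
    values on each atom. *)
Let G (c : nat -> R -> R) w : R := \sum_(1 <= k < n.+1) \sum_(e <- signs R)
  c k e * (\1_[set w | K w = k] w * \1_[set w | E w = e] w).

Let bdd_mfun_term c k e :
  bdd_mfun (fun w => c k e * (\1_[set w | K w = k] w * \1_[set w | E w = e] w) : R).
Proof.
by apply: bdd_mfunZ; apply: bdd_mfunM; apply: bdd_mfun_indic;
  [exact: measurable_eqn|exact: measurable_eq].
Qed.

Let bdd_mfun_past x : bdd_mfun (\1_(past X n x) : T -> R).
Proof. by apply: bdd_mfun_indic; exact: measurable_past. Qed.

Let bdd_mfun_G c : bdd_mfun (G c).
Proof. by do 2 (apply: bdd_mfun_sum => ?); exact: bdd_mfun_term. Qed.

Let GE c w : G c w =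
  if (0 < K w <= n)%N && (E w \in signs R) then c (K w) (E w) else 0.
Proof.
rewrite /G.
under eq_bigr => k _.
  under eq_bigr => e _.
    rewrite !indicE (_ : (w \in [set w | K w = k]) = (K w == k)); last first.
      by apply/idP/eqP; rewrite inE.
    rewrite (_ : (w \in [set w | E w = e]) = (E w == e)); last first.
      by apply/idP/eqP; rewrite inE.
    rewrite mulrA.
    over.
  rewrite sum_pick ?uniq_signs//.
  rewrite (_ : (if _ then _ else _) =
    (if E w \in signs R then c k (E w) else 0) * (K w == k)%:R); last first.
    by case: ifP; rewrite ?mul0r.
  over.
rewrite sum_pick ?iota_uniq// mem_index_iota ltnS.
by case: (_ && _) => //=; case: ifP.
Qed.

Let Ex_pastG c x : Ex (fun w => \1_(past X n x) w * G c w) =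
  Ex (\1_(past X n x)) *
  \sum_(1 <= k < n.+1) (c k 1 * p + c k (-1) * q + c k 0 * r) / n%:R.
Proof.
rewrite mulr_sumr /G.
under eq_Rintegral => w _.
  rewrite mulr_sumr; under eq_bigr do rewrite mulr_sumr.
  over.
rewrite Ex_sum; last by move=> k; apply: bdd_mfun_sum => e; exact: bdd_mfunM.
apply: eq_big_nat => k k1n.
rewrite Ex_sum; last by move=> e; exact: bdd_mfunM.
rewrite -sum_signs_pmf mulr_suml mulr_sumr; apply: eq_bigr => e _.
transitivity (c k e * Ex (\1_(past X n x `&` [set w | K w = k] `&` [set w | E w = e]))).
  rewrite -ExZ; last first.
    apply: bdd_mfun_indic; apply: measurableI; last exact: measurable_eq.
    by apply: measurableI; [exact: measurable_past|exact: measurable_eqn].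
  by apply: eq_Rintegral => w _; rewrite !indicI /= mulrCA !mulrA.
rewrite !Ex_indic; [|exact: measurable_past|]; last first.
  apply: measurableI; last exact: measurable_eq.
  by apply: measurableI; [exact: measurable_past|exact: measurable_eqn].
rewrite law//.
have mp := measurable_past n x.
rewrite -(fineK (fin_num_measure P _ mp)) -!EFinM /=.
by ring.
Qed.

(** The probabilities prescribed on the admissible values add up to that of the
    atom, so nothing is left for other values. *)
Let ae_KE : {ae P, forall w, (0 < K w <= n)%N && (E w \in signs R)}.
Proof.
have G1 w : G (fun _ _ => 1) w = ((0 < K w <= n)%N && (E w \in signs R))%:R.
  by rewrite GE; case: ifP.
have b1 : bdd_mfun (fun w => 1 - G (fun _ _ => 1) w) by apply: bdd_mfunB => //;
  exact: bdd_mfun_cst.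
have : Ex (fun w => 1 - G (fun _ _ => 1) w) = 0.
  apply: (Ex_past_eq0 sX) => // x.
  under eq_Rintegral do rewrite mulrC mulrBr mulr1.
  rewrite ExB//; last exact: bdd_mfunM.
  rewrite Ex_pastG !mul1r pqr sumr_const_nat subSS subn0 mul1r.
  by rewrite -[n%:R^-1 *+ n]mulr_natr mulVf ?mulr1 ?subrr// pnatr_eq0 -lt0n.
move=> EG0.
have : {ae P, forall w, 1 - G (fun _ _ => 1) w = 0}.
  by apply: (Ex_eq0 b1 _ EG0) => w; rewrite G1 subr_ge0 lern1 leq_b1.
apply: filterS => w /eqP.
by rewrite G1; case: (_ && _) => //; rewrite subr0 oner_eq0.
Qed.

(** The remembered time is almost surely in the past, hence the new step is a
    product of two elements of the list. *)
Lemma signs_uptoS : signs_upto n.+1.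
Proof.
apply: filterS3 sX ae_KE XKE => w sw /andP[Kw Ew] Xw i /andP[i1].
rewrite leq_eqVlt => /predU1P[->|i_n]; last by apply: sw; rewrite i1.
rewrite Xw; have := sw _ Kw; move: Ew; rewrite !inE.
by move=> /or3P[] /eqP-> /or3P[] /eqP->;
  rewrite ?(mulr0, mul0r, mulr1, mul1r, mulrN1, opprK, oppr0, eqxx, orbT).
Qed.

(** On an atom the new step is nonzero when the remembered entry of x is nonzero
    and the sign is 1 or -1: probability (p + q) / n for each nonzero entry. *)
Let Ex_past_step x :
  Ex (fun w => (X n.+1 w != 0)%:R * \1_(past X n x) w) =
  (1 - r) / n%:R * (\sum_(1 <= k < n.+1) (x k != 0)%R)%N%:R * Ex (\1_(past X n x)).
Proof.
rewrite (@Ex_ae_eq _ _ _ _ _ (fun w => \1_(past X n x) w *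
    G (fun k e => (e * x k != 0)%:R) w)).
- rewrite Ex_pastG mulrC; congr (_ * _).
  rewrite natr_sum mulr_sumr; apply: eq_bigr => k _.
  rewrite mul1r mulN1r oppr_eq0 mul0r eqxx mul0r addr0 -mulrDr.
  rewrite (_ : p + q = 1 - r); last by rewrite -pqr addrK.
  by rewrite -mulrA mulrC.
- by have [] := bdd_mfunM (bdd_mfun_ones n.+1) (bdd_mfun_past x).
- by have [] := bdd_mfunM (bdd_mfun_past x) (bdd_mfun_G (fun k e => (e * x k != 0)%:R)).
- apply: filterS2 ae_KE XKE => w KE Xw; rewrite GE KE Xw indicE.
  case: (boolP (w \in past X n x)) => [|_]; last by rewrite mulr0 mul0r.
  by rewrite inE => /(_ (K w)) ->; [rewrite mulr1 mul1r|have /andP[] := KE].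
Qed.

(** On each atom psi and the number of ones are constant, which reduces the claim
    to the case of the indicator of the atom. *)
Lemma Ex_step (psi : T -> R) : bdd_mfun psi ->
  depends_on_past X n psi ->
  Ex (fun w => psi w * (X n.+1 w != 0)%:R) =
  (1 - r) / n%:R * Ex (fun w => psi w * (nb_ones X n w)%:R).
Proof.
move=> bpsi hpsi.
have bN := bdd_mfun_nb_ones (fun j => j%:R) n.
have b1 : bdd_mfun (fun w => psi w * (X n.+1 w != 0)%:R).
  by apply: bdd_mfunM => //; exact: bdd_mfun_ones.
have b2 : bdd_mfun (fun w => (1 - r) / n%:R * (psi w * (nb_ones X n w)%:R)).
  by apply: bdd_mfunZ; apply: bdd_mfunM.
apply/eqP; rewrite -subr_eq0 -ExZ; last exact: bdd_mfunM.
rewrite -ExB//; apply/eqP/(Ex_past_eq0 sX); first exact: bdd_mfunB.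
move=> x; have [pe|/set0P[w0 pw0]] := eqVneq (past X n x) set0.
  under eq_Rintegral do rewrite pe indic0 mulr0.
  by rewrite Ex_cst.
pose N := (\sum_(1 <= k < n.+1) (x k != 0)%R)%N.
rewrite (_ : (fun w => _) = (fun w => psi w0 *
   ((X n.+1 w != 0)%:R * \1_(past X n x) w -
    (1 - r) / n%:R * N%:R * \1_(past X n x) w))); last first.
  apply/funext => w; rewrite indicE.
  case: (boolP (w \in past X n x)) => [|_]; last by rewrite !mulr0 subrr mulr0.
  rewrite inE => pw; rewrite !mulr1 (hpsi w w0).
    rewrite mulrBr; congr (_ - _).
    rewrite (_ : nb_ones X n w = N) 1?mulrCA 1?[RHS]mulrC//; last first.
      by apply: eq_big_nat => k k1n; rewrite pw.
    by ring.
  by move=> i i1n; rewrite pw// pw0.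
have b3 : bdd_mfun (fun w => (X n.+1 w != 0)%:R * \1_(past X n x) w : R).
  by apply: bdd_mfunM => //; exact: bdd_mfun_ones.
have b4 : bdd_mfun (fun w => (1 - r) / n%:R * N%:R * \1_(past X n x) w).
  by apply: bdd_mfunZ.
rewrite ExZ; last exact: bdd_mfunB.
by rewrite ExB// ExZ// Ex_past_step subrr mulr0.
Qed.

End one_step.

End steps.

(** The range of the steps up to time n is needed to cover the space by atoms of
    length n, and it is known up to n + 1 only after the law of the remembered
    time has been used; hence the induction. *)
Lemma ERWS_ones_chain d (T : measurableType d) (R : realType) (P : probability T R)
    (p q r s : R) (X : nat -> {RV P >-> R}) : p + q + r = 1 -> ERWS p q r s X ->
  (forall n, signs_upto X n) /\ ones_chain P X (1 - r).
Proof.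
move=> pqr [P1 PN1 [K [E KE]]].
have ae1 : {ae P, forall w, X 1%N w = 1 \/ X 1%N w = -1}.
  pose A := [set w | X 1%N w = 1] `|` [set w | X 1%N w = -1].
  have mA : measurable A by apply: measurableU; exact: measurable_eq.
  have PA : P A = 1%E.
    rewrite measureU; [|exact: measurable_eq|exact: measurable_eq|].
      transitivity (s%:E + (1 - s)%:E)%E; last by rewrite -EFinD subrKC.
      by congr (_ + _)%E; [exact: P1|exact: PN1].
    by apply/seteqP; split => // w [/= -> /eqP]; apply/negP/eqP; lra.
  exists (~` A); split; first exact: measurableC.
    by rewrite probability_setC// PA subee.
  by apply: subsetC => w.
have s1 : signs_upto X 1.
  apply: filterS ae1 => w w1 i; rewrite -eqn_leq => /eqP <-.
  by rewrite !inE; case: w1 => ->; rewrite eqxx ?orbT.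
have sS n : signs_upto X n.+1.
  elim: n => // n ih; have [XKE law] := KE n.+1 isT.
  exact: (signs_uptoS pqr _ XKE law).
split.
  case=> //; apply: aeW => w i /andP[i1]; rewrite leqn0 => /eqP i0.
  by rewrite i0 in i1.
split.
  apply: filterS ae1 => w w1; rewrite /nb_ones big_nat1.
  by case: w1 => ->; rewrite ?oppr_eq0 oner_eq0.
case=> // n psi _; have [XKE law] := KE n.+1 isT.
exact: (Ex_step pqr _ XKE law).
Qed.

(** * Eigenfunctions of the chain *)

Definition rising_fact (R : realType) (m j : nat) : R := \prod_(i < m) (j + i)%:R.

(** The rising factorial of order -1/2, that is Gamma (j - 1/2) / Gamma j up to a
    constant. At j = 0 the equation of eigenfunctions forces the value 0. *)
Definition rising_neg_half (R : realType) (j : nat) : R :=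
  (j != 0)%N%:R * euler_prod (- 2^-1) j.

Section eigenfunctions.
Variable R : realType.

(** Eigenfunctions of the generator of the chain, up to the factor a / n that
    carries the dependence on time. *)
Definition eigen (lam : R) (phi : nat -> R) :=
  forall j, j%:R * (phi j.+1 - phi j) = lam * phi j.

Lemma eigen_rising_fact m : eigen m%:R (rising_fact R m).
Proof.
move=> j; have h : j%:R * rising_fact R m j.+1 = rising_fact R m j * (j + m)%:R.
  have -> : rising_fact R m j * (j + m)%:R = rising_fact R m.+1 j.
    by rewrite /rising_fact big_ord_recr.
  rewrite [RHS]/rising_fact big_ord_recl addn0; congr (_ * _).
  by apply: eq_bigr => i _; rewrite /bump /= addnCA add1n addSn.
by rewrite mulrBr h natrD; ring.
Qed.

Lemma eigen_id : eigen 1 (fun j => j%:R).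
Proof. by move=> j; rewrite -natr1 addrAC subrr add0r mulr1 mul1r. Qed.

Lemma eigen_rising_neg_half : eigen (- 2^-1) (rising_neg_half R).
Proof.
case=> [|j]; first by rewrite /rising_neg_half eqxx !mul0r mulr0.
rewrite /rising_neg_half /= !mul1r [euler_prod _ j.+2]euler_prodS//.
have : j.+1%:R != 0 :> R by rewrite pnatr_eq0.
by move: (j.+1%:R) (euler_prod _ _) => x y x0; field.
Qed.

Lemma rising_fact1 m : rising_fact R m 1 = m`!%:R.
Proof.
elim: m => [|m ih]; first by rewrite /rising_fact big_ord0 fact0.
by rewrite /rising_fact big_ord_recr/= -/(rising_fact R m 1) ih factS mulrC natrM add1n.
Qed.

Lemma rising_fact_ge m j : j%:R ^+ m <= rising_fact R m j.
Proof.
rewrite -[m in leLHS]card_ord -prodr_const; apply: ler_prod => i _.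
by rewrite ler0n ler_nat leq_addr.
Qed.

Lemma rising_fact_ge0 m j : 0 <= rising_fact R m j.
Proof. by apply: prodr_ge0. Qed.

(** Second moments of rising factorials are controlled by first moments of longer
    ones, which are explicit. *)
Lemma rising_fact_sqr m j : rising_fact R m j ^+ 2 <= rising_fact R (m + m) j.
Proof.
rewrite expr2 /rising_fact big_split_ord/= ler_wpM2l ?prodr_ge0//.
by apply: ler_prod => i _; rewrite ler0n ler_nat leq_add2l leq_addl.
Qed.

Lemma euler_prod_half_gt0 n (a : R) : 0 <= a <= 1 -> 0 < euler_prod (- (2^-1 * a)) n.
Proof.
move=> /andP[a0 a1]; rewrite /euler_prod big_seq; elim/big_ind: _ => //.
  by move=> x y; exact: mulr_gt0.
move=> k; rewrite mem_index_iota => /andP[k1 _].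
have k0 : 1 <= k%:R :> R by rewrite ler1n.
have : 2^-1 * a / k%:R <= 2^-1 * a / 1.
  by apply: ler_wpM2l; [lra|rewrite lef_pV2 ?posrE//; lra].
by rewrite mulNr; lra.
Qed.

(** Write phi for the function. The induction proves the slightly stronger bound
    1 <= 4 j phi (j + 1)^2: the right-hand side is nondecreasing in j and equal
    to 1 at j = 1. *)
Lemma rising_neg_half_ge j : (0 < j)%N -> 1 <= 4 * j%:R * rising_neg_half R j ^+ 2.
Proof.
case: j => // j _; rewrite /rising_neg_half/= mul1r.
case: j => [|j]; first by rewrite euler_prod1; lra.
suff h : 1 <= 4 * j.+1%:R * euler_prod (- 2^-1 : R) j.+2 ^+ 2.
  apply: (le_trans h); rewrite ler_wpM2r ?sqr_ge0// ler_wpM2l// ler_nat//.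
elim: j => [|j ih].
  by rewrite euler_prodS// euler_prod1; lra.
rewrite euler_prodS//; move: (euler_prod _ _) ih => y ih.
rewrite -[j.+2%:R]natr1.
have : 0 < j.+1%:R :> R by rewrite ltr0n.
move: (j.+1%:R : R) ih => x ih x0.
have -> : 4 * (x + 1) * (y * (1 + - 2^-1 / (x + 1))) ^+ 2
  = 4 * x * y ^+ 2 + y ^+ 2 / (x + 1) by field; lra.
apply: le_trans ih _; rewrite lerDl divr_ge0 ?sqr_ge0//; lra.
Qed.

(** (1 - u) (1 + u) <= 1 in each factor. *)
Lemma euler_prod_half_le n (a : R) : 0 <= a <= 1 ->
  euler_prod (- (2^-1 * a)) n <= (euler_prod (2^-1 * a) n)^-1.
Proof.
move=> a01; have /andP[a0 a1] := a01.
have p0 : 0 < euler_prod (2^-1 * a) n by apply: euler_prod_gt0; lra.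
rewrite -[leRHS]mul1r ler_pdivlMr// /euler_prod -big_split/=.
rewrite big_seq; apply: (@le_trans _ _ (\prod_(i <- index_iota 1 n | i \in index_iota 1
  n) 1)); last by rewrite big1.
apply: ler_prod => k; rewrite mem_index_iota => /andP[k1 _].
have k0 : 1 <= k%:R :> R by rewrite ler1n.
have h : 2^-1 * a / k%:R <= 2^-1 * a / 1.
  by apply: ler_wpM2l; [lra|rewrite lef_pV2 ?posrE//; lra].
have h0 : 0 <= 2^-1 * a / k%:R by rewrite divr_ge0//; lra.
by rewrite mulNr; move: (2^-1 * a / k%:R) h h0 => u h h0; nra.
Qed.

(** 1 + 2 u <= (1 + u)^2 for the new factor. *)
Lemma euler_prod2_le n (a : R) : (0 < n)%N -> 0 <= a ->
  euler_prod (2 * a) n.+1 / euler_prod a n.+1 ^+ 2 <= euler_prod (2 * a) n / euler_prod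
    a n ^+ 2.
Proof.
move=> n0 a0; rewrite !euler_prodS//.
have p0 : 0 < euler_prod a n by exact: euler_prod_gt0.
have q0 : 0 <= euler_prod (2 * a) n by apply/ltW/euler_prod_gt0; lra.
have u0 : 0 <= a / n%:R by rewrite divr_ge0.
rewrite -(mulrA 2 a).
move: (a / n%:R) (euler_prod a n) (euler_prod _ n) u0 p0 q0 => u p q u0 p0 q0.
rewrite exprMn ler_pdivrMr; last by rewrite mulr_gt0 ?exprn_gt0//; lra.
rewrite mulrA divfK ?gt_eqF ?exprn_gt0//.
by apply: ler_wpM2l => //; nra.
Qed.

End eigenfunctions.

Lemma pow_absB_le (R : realFieldType) (x y : R) m : 0 <= x -> 0 <= y ->
  `|x - y| ^+ m <= 2 ^+ m * (x ^+ m + y ^+ m).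
Proof.
move=> x0 y0; wlog xy : x y x0 y0 / x <= y => [H|].
  have [/H|/ltW /H] := leP x y; first exact.
  by rewrite distrC [y ^+ m + _]addrC; apply.
apply: (@le_trans _ _ ((2 * y) ^+ m)).
  by apply: lerXn2r; rewrite ?nnegrE ?mulr_ge0// distrC ger0_norm ?subr_ge0//; lra.
by rewrite exprMn ler_wpM2l ?exprn_ge0// lerDr exprn_ge0.
Qed.

Section ones_chain.
Context d (T : measurableType d) (R : realType) (P : probability T R).
Variables (X : nat -> {RV P >-> R}) (a : R).
Hypothesis a01 : 0 < a <= 1.
Hypothesis chain : ones_chain P X a.
Local Notation Ex f := (\int[P]_w (f w)).
Local Notation S := (nb_ones X).

Let a0 : 0 < a. Proof. by case/andP: a01. Qed.
Let first_one : {ae P, forall w, nb_ones X 1 w = 1%N}. Proof. exact: chain.1. Qed.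
Let one_step := chain.2.

(** * Moments of the number of ones *)

Lemma nb_ones_past n w w' :
  (forall i, (1 <= i <= n)%N -> X i w = X i w') -> S n w = S n w'.
Proof. by move=> h; apply: eq_big_nat => k kn; rewrite h. Qed.

Lemma Ex_eigenS lam phi n psi : eigen lam phi -> (0 < n)%N -> bdd_mfun psi ->
  depends_on_past X n psi ->
  Ex (fun w => psi w * phi (S n.+1 w)) =
  (1 + a * lam / n%:R) * Ex (fun w => psi w * phi (S n w)).
Proof.
move=> ephi n0 bpsi hpsi.
have bphi := bdd_mfun_nb_ones X phi n.
have bphiS := bdd_mfun_nb_ones X (fun j => phi j.+1) n.
have bd : bdd_mfun (fun w => phi (S n w).+1 - phi (S n w)) by exact: bdd_mfunB.
rewrite (_ : (fun w => _) = (fun w => psi w * phi (S n w) +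
  (psi w * (phi (S n w).+1 - phi (S n w))) * (X n.+1 w != 0)%:R)); last first.
  apply/funext => w; rewrite nb_onesS; case: (X n.+1 w != 0).
    by rewrite addn1 mulr1 -mulrDr subrKC.
  by rewrite addn0 mulr0 addr0.
rewrite ExD; [|exact: bdd_mfunM|]; last first.
  by apply: bdd_mfunM; [exact: bdd_mfunM|exact: bdd_mfun_ones].
rewrite one_step//; last 2 first.
- exact: bdd_mfunM.
- by move=> w w' ww'; rewrite (hpsi _ _ ww') (nb_ones_past ww').
rewrite (_ : (fun w => _ * (S n w)%:R) = (fun w => lam * (psi w * phi (S n w))));
  last first.
  by apply/funext => w; rewrite -mulrA [_ * (S n w)%:R]mulrC ephi mulrCA.
rewrite ExZ; last exact: bdd_mfunM.
by ring.
Qed.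

(** The identity is free of division because the product vanishes for some negative
    values of a * lam. *)
Lemma Ex_eigen lam phi n l psi : eigen lam phi -> (0 < n <= l)%N -> bdd_mfun psi ->
  depends_on_past X n psi ->
  euler_prod (a * lam) n * Ex (fun w => psi w * phi (S l w)) =
  euler_prod (a * lam) l * Ex (fun w => psi w * phi (S n w)).
Proof.
move=> ephi /andP[n0 nl] bpsi hpsi; elim: l nl => [|l ih].
  by rewrite leqn0 => /eqP n1; rewrite n1 in n0.
rewrite leq_eqVlt => /predU1P[<-//|]; rewrite ltnS => nl.
have l0 : (0 < l)%N by exact: leq_trans nl.
rewrite (Ex_eigenS ephi)//; last first.
  move=> w w' ww'; apply: hpsi => i /andP[i1 i_n]; apply: ww'.
  by rewrite i1 (leq_trans i_n).
by rewrite mulrCA ih// euler_prodS//; ring.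
Qed.

Lemma Ex_eigen1 lam phi n : eigen lam phi -> (0 < n)%N ->
  Ex (fun w => phi (S n w)) = euler_prod (a * lam) n * phi 1%N.
Proof.
move=> ephi n0.
have := @Ex_eigen lam phi 1 n (fun=> 1) ephi.
rewrite n0 => /(_ isT (bdd_mfun_cst _ 1)) /(_ (fun _ _ _ => erefl)).
rewrite euler_prod1 mul1r; under eq_Rintegral do rewrite mul1r.
move=> ->; congr (_ * _); under eq_Rintegral do rewrite mul1r.
rewrite -[RHS](Ex_cst P); apply: Ex_ae_eq.
- by have [] := bdd_mfun_nb_ones X phi 1.
- exact: measurable_cst.
- by apply: filterS first_one => w ->.
Qed.

Lemma Ex_rising_fact m n : (0 < n)%N ->
  Ex (fun w => rising_fact R m (S n w)) = euler_prod (a * m%:R) n * m`!%:R.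
Proof. by move=> n0; rewrite (Ex_eigen1 (@eigen_rising_fact R m))// rising_fact1. Qed.

Lemma Ex_rising_neg_half n : (0 < n)%N ->
  Ex (fun w => rising_neg_half R (S n w)) = euler_prod (- (2^-1 * a)) n.
Proof.
move=> n0; rewrite (Ex_eigen1 (@eigen_rising_neg_half R))//.
by rewrite /rising_neg_half/= euler_prod1 !mulr1 mulrN mulrC.
Qed.

(** Dividing S_n by A_n = euler_prod a n gives a martingale, whose increments are
    orthogonal, so the left-hand side is the difference of the second moments at
    times l and n. The second moment at n is 2 B_n / A_n^2 - 1 / A_n with
    B_n = euler_prod (2 a) n; the first quotient does not increase, and 1 / A_n is
    what remains. *)
Lemma Ex_increment_sqr n l : (0 < n <= l)%N ->
  Ex (fun w => ((S l w)%:R / euler_prod a l - (S n w)%:R / euler_prod a n) ^+ 2)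
  <= (euler_prod a n)^-1.
Proof.
move=> /andP[n0 nl]; have l0 : (0 < l)%N by exact: leq_trans nl.
have pos k : 0 < euler_prod a k by apply: euler_prod_gt0; exact: ltW.
have b k : bdd_mfun (fun w => (S k w)%:R : R) := bdd_mfun_nb_ones X (fun j => j%:R) k.
have b2 k j : bdd_mfun (fun w => (S k w)%:R * (S j w)%:R : R) by exact: bdd_mfunM.
have E1 k : (0 < k)%N -> Ex (fun w => (S k w)%:R) = euler_prod a k.
  by move=> k0; rewrite (Ex_eigen1 (@eigen_id R))// !mulr1.
have E2 k : (0 < k)%N -> Ex (fun w => (S k w)%:R * (S k w)%:R) =
    2 * euler_prod (2 * a) k - euler_prod a k.
  move=> k0; rewrite -[euler_prod a k]E1// [2 * a]mulrC [2 * euler_prod _ _]mulrC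
    -(Ex_rising_fact 2)//.
  rewrite -ExB//; last exact: bdd_mfun_nb_ones.
  apply: eq_Rintegral => w _; rewrite /rising_fact !big_ord_recl big_ord0/= addn0 addn1.
  by rewrite mulr1 -natr1; ring.
have Ec : euler_prod a n * Ex (fun w => (S n w)%:R * (S l w)%:R) =
    euler_prod a l * Ex (fun w => (S n w)%:R * (S n w)%:R).
  have := @Ex_eigen 1 (fun j => j%:R) n l (fun w => (S n w)%:R) (@eigen_id R).
  rewrite n0 nl mulr1; apply => //.
  by move=> w w' /nb_ones_past ->.
have dec : euler_prod (2 * a) l / euler_prod a l ^+ 2 <= euler_prod (2 * a) n /
  euler_prod a n ^+ 2.
  elim: l nl {l0 Ec} => [|l ih]; first by rewrite leqn0 => /eqP->.
  rewrite leq_eqVlt => /predU1P[<-//|]; rewrite ltnS => nl.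
  by apply: le_trans (ih nl); apply: euler_prod2_le; [exact: leq_trans n0 nl|exact: ltW].
pose A := euler_prod a l; pose B := euler_prod a n.
rewrite (_ : (fun w => _) = (fun w => A^-1 ^+ 2 * ((S l w)%:R * (S l w)%:R) +
   (B^-1 ^+ 2 * ((S n w)%:R * (S n w)%:R) -
    (2 * A^-1 * B^-1) * ((S n w)%:R * (S l w)%:R)))); last first.
  by apply/funext => w; rewrite -/A -/B; ring.
rewrite ExD; [|exact: bdd_mfunZ|by apply: bdd_mfunB; exact: bdd_mfunZ].
rewrite ExB; [|exact: bdd_mfunZ|exact: bdd_mfunZ].
rewrite !ExZ//.
(* the martingale property between times n and l *)
have -> : Ex (fun w => (S n w)%:R * (S l w)%:R) = A / B * Ex (fun w => (S n w)%:R * (S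
  n w)%:R).
  by rewrite mulrAC -Ec mulrC mulKf ?gt_eqF// pos.
rewrite !E2//.
have A0 := pos l; have B0 := pos n.
have -> : A^-1 ^+ 2 * (2 * euler_prod (2 * a) l - euler_prod a l) +
   (B^-1 ^+ 2 * (2 * euler_prod (2 * a) n - euler_prod a n) -
   2 / A / B * (A / B * (2 * euler_prod (2 * a) n - euler_prod a n)))
  = 2 * (euler_prod (2 * a) l / A ^+ 2 - euler_prod (2 * a) n / B ^+ 2) - A^-1 + B^-1.
  rewrite /A /B in A0 B0 *; field; lra.
have : 0 < A^-1 by rewrite invr_gt0.
by rewrite -/A -/B in dec *; lra.
Qed.

Lemma nb_ones_nondecreasing w : nondecreasing_seq (fun n => S n w).
Proof. by apply/nondecreasing_seqP => n; rewrite nb_onesS leEnat leq_addr. Qed.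

(** * Almost sure convergence *)

(** The martingale has summable mean increments along the times (k + 1)^L when L
    is large, and monotonicity of the number of ones does the rest. *)
Lemma ae_cvg_nb_ones :
  {ae P, forall w, cvgn (fun n => (S n w)%:R / n%:R `^ a)}.
Proof.
have [C C0 hC] := euler_prod_inv_le (ltW a0).
(* L * a >= 4 makes the second moment of the k-th increment O((k + 1)^-4) *)
pose L := (Num.truncn (4 / a)).+1.
have L4 : 4 <= L%:R * a.
  by rewrite -ler_pdivrMr//; apply: ltW; exact: truncnS_gt.
pose N k := (k.+1 ^ L)%N.
have N0 k : (0 < N k)%N by rewrite expn_gt0.
pose W n w := (S n w)%:R / euler_prod a n.
have bW n : bdd_mfun (W n) := bdd_mfun_nb_ones X (fun j => j%:R / euler_prod a n) n.
pose D k w := `|W (N k.+1) w - W (N k) w|.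
have bD k : bdd_mfun (D k).
  have [m [M hM]] := bdd_mfunB (bW (N k.+1)) (bW (N k)).
  by split; [exact: measurableT_comp|exists M => w; rewrite normr_id].
have ED k : Ex (D k) <= (C + 1) / 2 * k.+1%:R ^- 2.
  pose c : R := k.+1%:R ^+ 2.
  have c0 : 0 < c by rewrite exprn_gt0.
  have bsq : bdd_mfun (fun w => (W (N k.+1) w - W (N k) w) ^+ 2).
    by apply: bdd_mfunX; exact: bdd_mfunB.
  apply: (@le_trans _ _ (Ex (fun w => c / 2 * (W (N k.+1) w - W (N k) w) ^+ 2 + (2 *
    c)^-1))).
    (* 2 |z| <= c z^2 + 1 / c; this c balances the two terms *)
    apply: Ex_le => // [|w].
      by apply: bdd_mfunD; [exact: bdd_mfunZ|exact: bdd_mfun_cst].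
    rewrite /D -[(W _ w - _) ^+ 2]real_normK ?num_real//.
    move: `|_| => z; rewrite -subr_ge0.
    have -> : c / 2 * z ^+ 2 + (2 * c)^-1 - z = (c * z - 1) ^+ 2 / (2 * c).
      by field; lra.
    by rewrite divr_ge0 ?sqr_ge0//; lra.
  rewrite ExD; [|exact: bdd_mfunZ|exact: bdd_mfun_cst].
  rewrite ExZ// Ex_cst.
  have h1 : Ex (fun w => (W (N k.+1) w - W (N k) w) ^+ 2) <= (euler_prod a (N k))^-1.
    by apply: Ex_increment_sqr; rewrite N0 /N leq_exp2r// leqnSn.
  have h2 : ((N k)%:R `^ a)^-1 <= (c ^+ 2)^-1.
    rewrite lef_pV2 ?posrE ?exprn_gt0 ?powR_gt0 ?ltr0n//.
    rewrite /c -exprM -powR_mulrn// natrX -powR_mulrn// -powRrM.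
    by apply: ler_powR => //; rewrite ler1n.
  have h3 : Ex (fun w => (W (N k.+1) w - W (N k) w) ^+ 2) <= C * (c ^+ 2)^-1.
    by apply: le_trans h1 _; apply: le_trans (hC _ (N0 k)) _; rewrite ler_pM2l.
  have h4 : c / 2 * Ex (fun w => (W (N k.+1) w - W (N k) w) ^+ 2) <= c / 2 * (C * (c ^+
    2)^-1).
    by apply: ler_wpM2l => //; rewrite divr_ge0// ltW.
  apply: (le_trans (lerD h4 (lexx _))).
  rewrite le_eqVlt; apply/orP; left; apply/eqP; rewrite -/c; field; lra.
have D0 k w : 0 <= D k w by rewrite /D.
have DM n : \sum_(0 <= k < n) Ex (D k) <= (C + 1) / 2 * 2.
  apply: (le_trans (ler_sum _ (fun k _ => ED k))).
  rewrite -mulr_sumr ler_pM2l; last by lra.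
  by apply: le_trans (sum_inv_sqr_le R n) _; rewrite gerBl.
apply: filterS (ae_cvg_series bD D0 DM) => w /normed_cvg.
move=> /cvg_ex[l hl].
have WN : W (N k) w @[k --> \oo] --> W (N 0%N) w + l.
  rewrite (_ : (fun k => _) = (fun k => W (N 0%N) w + series (telescope (fun k => W (N
    k) w)) k)).
    by apply: cvgD => //; exact: cvg_cst.
  by apply/funext => k; rewrite [LHS](eq_sum_telescope (fun k => W (N k) w)).
apply/cvg_ex; exists ((W (N 0%N) w + l) * (Gamma (1 + a))^-1).
have Linc : N k @[k --> \oo] --> \oo.
  apply/cvgnyPge => m; near=> k.
  have mk : (m <= k)%N by near: k; exact: nbhs_infty_ge.
  by rewrite (leq_trans mk)// (leq_trans (leqnSn k))// -[X in (X <= _)%N]expn1 leq_pexp2l.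
apply: (@cvg_subseq_powers _ _ L) => //.
- by rewrite (ltW a0); case/andP: a01.
- by apply/nondecreasing_seqP => n; rewrite ler_nat nb_onesS leq_addr.
- rewrite (_ : (fun k => _) = (fun k => W (N k) w * (euler_prod a (N k) / (N k)%:R `^ a))).
    apply: cvgM => //.
    exact: (cvg_comp _ _ Linc (euler_prod_cvg (ltW a0))).
  apply/funext => k; rewrite /W mulrA divfK// gt_eqF//.
  by apply: euler_prod_gt0; exact: ltW.
Unshelve. all: by end_near. Qed.

(** * The limit *)

Definition scaled_ones n w : R := (S n w)%:R / n%:R `^ a.
Local Notation Y := scaled_ones.

(** An upper limit is measurable without any convergence assumption. The absolute
    value makes the limit nonnegative everywhere, and not only almost surely. *)
Definition ones_limit w : R := `|fine (limn_esup (fun n => (Y n w)%:E))|.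
Local Notation Sig := ones_limit.

Lemma bdd_mfun_scaled_ones n : bdd_mfun (Y n).
Proof. exact: (bdd_mfun_nb_ones X (fun j => j%:R / n%:R `^ a) n). Qed.

Lemma scaled_ones_ge0 n w : 0 <= Y n w.
Proof. by rewrite divr_ge0// powR_ge0. Qed.

Lemma measurable_ones_limit : measurable_fun setT Sig.
Proof.
apply: measurableT_comp => //; apply: measurableT_comp => //.
apply: measurable_fun_limn_esup => n; apply/measurable_EFinP.
by have [] := bdd_mfun_scaled_ones n.
Qed.

Lemma ones_limit_ge0 w : 0 <= Sig w. Proof. exact: normr_ge0. Qed.

Lemma ae_cvg_scaled_ones : {ae P, forall w, Y n w @[n --> \oo] --> Sig w}.
Proof.
apply: filterS ae_cvg_nb_ones => w /cvg_ex[l Yl].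
suff -> : Sig w = l by exact: Yl.
have l0 : 0 <= l.
  rewrite -(cvg_lim _ Yl)//; apply: limr_ge; first by apply/cvg_ex; exists l.
  by apply: nearW => n; exact: scaled_ones_ge0.
rewrite /Sig; have -> : limn_esup (fun n => (Y n w)%:E) = l%:E.
  have YlE : (Y n w)%:E @[n --> \oo] --> l%:E by apply: cvg_EFin => //; exact: nearW.
  rewrite is_cvg_limn_esupE; last by apply/cvg_ex; eexists; exact: YlE.
  exact/cvg_lim.
by rewrite /= ger0_norm.
Qed.

(** Same limit as the m-th power of the scaled number of ones, but with an
    explicit expectation. *)
Definition scaled_rising m n w : R := rising_fact R m (S n w) / (n%:R `^ a) ^+ m.
Local Notation Rm := scaled_rising.

Lemma bdd_mfun_scaled_rising m n : bdd_mfun (Rm m n).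
Proof. exact: (bdd_mfun_nb_ones X (fun j => rising_fact R m j / (n%:R `^ a) ^+ m) n). Qed.

Lemma scaled_rising_ge0 m n w : 0 <= Rm m n w.
Proof. by rewrite divr_ge0// ?rising_fact_ge0// exprn_ge0// powR_ge0. Qed.

Lemma scaled_onesX_le m n w : Y n w ^+ m <= Rm m n w.
Proof.
by rewrite /Y expr_div_n ler_wpM2r ?rising_fact_ge// invr_ge0 exprn_ge0// powR_ge0.
Qed.

Lemma scaled_rising_sqr m n w : Rm m n w ^+ 2 <= Rm (m + m) n w.
Proof.
rewrite /Rm expr_div_n -exprM muln2 addnn ler_wpM2r//.
by rewrite -addnn rising_fact_sqr.
Qed.

(** Each factor (S_n + i) / n^a has the same limit as S_n / n^a. *)
Lemma cvg_scaled_rising m w : Y n w @[n --> \oo] --> Sig w ->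
  Rm m n w @[n --> \oo] --> Sig w ^+ m.
Proof.
move=> YS; rewrite /Rm.
have inv0 : (n%:R `^ a)^-1 @[n --> \oo] --> (0 : R).
  apply/gtr0_cvgV0; last exact: powR_cvgy a0.
  near=> n; rewrite powR_gt0// ltr0n.
  by near: n; exact: nbhs_infty_gt.
elim: m => [|m ih].
  rewrite (_ : (fun n => _) = cst 1); first exact: cvg_cst.
  by apply/funext => n; rewrite /rising_fact big_ord0 expr0 divr1.
rewrite (_ : (fun n => _) = (fun n => (rising_fact R m (S n w) / (n%:R `^ a) ^+ m) *
   (Y n w + m%:R * (n%:R `^ a)^-1))).
  rewrite exprSr; apply: cvgM; first exact: ih.
  rewrite -[X in _ --> X]addr0; apply: cvgD; first exact: YS.
  by rewrite -[X in _ --> X](mulr0 m%:R); apply: cvgMr.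
apply/funext => n; rewrite /rising_fact big_ord_recr/= exprSr invfM natrD /Y.
by ring.
Unshelve. all: by end_near. Qed.

Lemma Ex_scaled_rising_cvg m :
  Ex (Rm m n) @[n --> \oo] --> m`!%:R / Gamma (1 + m%:R * a).
Proof.
have am0 : 0 <= a * m%:R by rewrite mulr_ge0// ltW.
have h : m`!%:R * (euler_prod (a * m%:R) n / n%:R `^ (a * m%:R)) @[n --> \oo] -->
    m`!%:R * (Gamma (1 + a * m%:R))^-1.
  by apply: cvgMr; exact: euler_prod_cvg.
rewrite [m%:R * a]mulrC; apply: cvg_trans h; apply: near_eq_cvg; near=> n.
rewrite /Rm /=.
rewrite (_ : (fun w => _) = (fun w => ((n%:R `^ a) ^+ m)^-1 * rising_fact R m (S n
  w))); last first.
  by apply/funext => w; rewrite mulrC.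
rewrite ExZ; last exact: bdd_mfun_nb_ones.
rewrite Ex_rising_fact; last by near: n; exact: nbhs_infty_gt.
by rewrite powRrM powR_mulrn ?powR_ge0//; ring.
Unshelve. all: by end_near. Qed.

Lemma Ex_scaled_rising_bounded m : exists B, forall n, Ex (Rm m n) <= B.
Proof.
have /cvg_seq_bounded/pinfty_ex_gt0[M M_gt0 /= uM] : cvgn (fun n => Ex (Rm m n)).
  by apply/cvg_ex; eexists; exact: Ex_scaled_rising_cvg.
by exists M => n; apply: le_trans (uM n Logic.I); exact: ler_norm.
Qed.

Lemma measurable_ones_limitX m : measurable_fun setT (fun w => Sig w ^+ m).
Proof. by apply: measurable_funX; exact: measurable_ones_limit. Qed.

(** Fatou's lemma, as the expectations of the scaled rising factorials converge
    and are therefore bounded. *)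
Lemma integrable_ones_limitX m : P.-integrable setT (EFin \o (fun w => Sig w ^+ m)).
Proof.
have [B hB] := Ex_scaled_rising_bounded m.
apply/integrableP; split; first by apply/measurable_EFinP; exact: measurable_ones_limitX.
apply: (@le_lt_trans _ _ B%:E); last exact: ltry.
apply: (@fatou_le _ _ _ P (Rm m)).
- by move=> n; have [] := bdd_mfun_scaled_rising m n.
- by move=> n w; exact: scaled_rising_ge0.
- apply: measurableT_comp => //.
  by apply/measurable_EFinP; exact: measurable_ones_limitX.
- apply: filterS ae_cvg_scaled_ones => w /(@cvg_scaled_rising m w) h.
  have Sm0 : 0 <= Sig w ^+ m by rewrite exprn_ge0// ones_limit_ge0.
  rewrite /= (ger0_norm Sm0).
  by apply: cvg_EFin => //; exact: nearW.
- move=> n; rewrite -[leLHS]fineK ?lee_fin//; first exact: hB.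
  by apply: integrable_fin_num => //; apply: bdd_mfun_integrable;
    exact: bdd_mfun_scaled_rising.
Qed.

(** The scaled rising factorials converge almost surely to the power of the limit
    and are bounded in L^2, hence their expectations converge to its expectation. *)
Lemma Ex_ones_limitX m : Ex (fun w => Sig w ^+ m) = m`!%:R / Gamma (1 + m%:R * a).
Proof.
have [B hB] := Ex_scaled_rising_bounded (m + m).
pose Z n w := `|Rm m n w - Sig w ^+ m|.
have iZ n : P.-integrable setT (EFin \o (fun w => Rm m n w - Sig w ^+ m)).
  have := @integrableB _ _ _ P setT measurableT (EFin \o Rm m n) (EFin \o (fun w => Sig
    w ^+ m)).
  by apply; [apply: bdd_mfun_integrable;
    exact: bdd_mfun_scaled_rising|exact: integrable_ones_limitX].
have mZ n : measurable_fun setT (fun w => Rm m n w - Sig w ^+ m).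
  apply: measurable_funB; last exact: measurable_ones_limitX.
  by have [] := bdd_mfun_scaled_rising m n.
pose G n w := 2 * (Rm (m + m) n w + Sig w ^+ (m + m)).
have iRS n : P.-integrable setT (EFin \o (fun w => Rm (m + m) n w + Sig w ^+ (m + m))).
  apply: integrable_EFinD => //; last exact: integrable_ones_limitX.
  by apply: bdd_mfun_integrable; exact: bdd_mfun_scaled_rising.
have iG n : P.-integrable setT (EFin \o G n) by exact: integrable_EFinM.
have ZG n w : Z n w ^+ 2 <= G n w.
  rewrite /Z real_normK ?num_real// /G.
  have := scaled_rising_sqr m n w; rewrite exprD.
  have := sqr_ge0 (Rm m n w + Sig w ^+ m).
  move: (Rm m n w) (Rm (m + m) n w) (Sig w ^+ m) => x y z; nra.
have iZ2 n : P.-integrable setT (EFin \o (fun w => Z n w ^+ 2)).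
  apply: (le_integrable _ _ _ (iG n)) => //.
    apply/measurable_EFinP; apply: measurable_funX.
    by apply: measurableT_comp => //; exact: mZ.
  move=> w _ /=; rewrite lee_fin ger0_norm ?sqr_ge0//.
  exact: le_trans (ZG n w) (ler_norm _).
have EZ0 : Ex (Z n) @[n --> \oo] --> (0 : R).
  apply: (@Ex_cvg0 _ _ _ P Z (2 * (B + Ex (fun w => Sig w ^+ (m + m))))) => //.
  - by move=> n; apply: measurableT_comp => //; exact: mZ.
  - by move=> n w; exact: normr_ge0.
  - apply: filterS ae_cvg_scaled_ones => w /(@cvg_scaled_rising m w) h.
    have -> : (0 : R) = `|Sig w ^+ m - Sig w ^+ m| by rewrite subrr normr0.
    by apply: cvg_norm; apply: cvgB => //; exact: cvg_cst.
  - by move=> n; exact: (integrable_norm (iZ n)).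
  - move=> n; apply: (@le_trans _ _ (Ex (G n))); first exact: le_Rintegral.
    rewrite /G RintegralZl// ler_pM2l// RintegralD//; last exact: integrable_ones_limitX.
      by rewrite lerD2r.
    by apply: bdd_mfun_integrable; exact: bdd_mfun_scaled_rising.
rewrite -(cvg_lim _ (@Ex_scaled_rising_cvg m))//; apply/esym/cvg_lim => //.
apply/cvgrPdist_le => e e0.
move/cvgrPdist_le/(_ _ e0) : EZ0; apply: filterS => n.
rewrite sub0r normrN => h.
rewrite distrC -RintegralB//; [|apply: bdd_mfun_integrable;
  exact: bdd_mfun_scaled_rising|exact: integrable_ones_limitX].
apply: le_trans (le_normr_Rintegral _ _) _ => //.
exact: le_trans (ler_norm _) h.
Qed.

Let iS m : P.-integrable setT (EFin \o (fun w => Sig w ^+ m)).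
Proof. exact: integrable_ones_limitX. Qed.
Let mS : measurable_fun setT Sig.
Proof. exact: measurable_ones_limit. Qed.

Let measurable_absX n m : measurable_fun setT (fun w => `|Y n w - Sig w| ^+ m).
Proof.
apply: measurable_funX; apply: measurableT_comp => //.
by apply: measurable_funB => //; have [] := bdd_mfun_scaled_ones n.
Qed.

Let bdd_mfunY n m : bdd_mfun (fun w => Y n w ^+ m).
Proof. by apply: bdd_mfunX; exact: bdd_mfun_scaled_ones. Qed.

Lemma integrable_scaled_ones_dist n m :
  P.-integrable setT (EFin \o (fun w => `|Y n w - Sig w| ^+ m)).
Proof.
have iG : P.-integrable setT (EFin \o (fun w => 2 ^+ m * (Y n w ^+ m + Sig w ^+ m))).
  apply: integrable_EFinM => //; apply: integrable_EFinD => //.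
  exact: bdd_mfun_integrable.
apply: (le_integrable _ _ _ iG) => //; first by apply/measurable_EFinP.
move=> w _ /=; rewrite lee_fin ger0_norm ?exprn_ge0//.
apply: le_trans (ler_norm _).
by apply: pow_absB_le; [exact: scaled_ones_ge0|exact: ones_limit_ge0].
Qed.

Lemma Ex_scaled_ones_dist_cvg0 m : (0 < m)%N ->
  Ex (fun w => `|Y n w - Sig w| ^+ m) @[n --> \oo] --> (0 : R).
Proof.
move=> m0; have [B hB] := Ex_scaled_rising_bounded (m * 2).
apply: (@Ex_cvg0 _ _ _ P _ (2 ^+ (m * 2) * (B + Ex (fun w => Sig w ^+ (m * 2))))) => //.
- apply: filterS ae_cvg_scaled_ones => w h.
  have h0 : `|Y n w - Sig w| @[n --> \oo] --> (0 : R).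
    have -> : (0 : R) = `|Sig w - Sig w| by rewrite subrr normr0.
    by apply: cvg_norm; apply: cvgB => //; exact: cvg_cst.
  case: m m0 {B hB} => // m _; elim: m => [|m ih]; first exact: h0.
  rewrite (_ : (fun n => _) = (fun n => `|Y n w - Sig w| * `|Y n w - Sig w| ^+ m.+1));
    last first.
    by apply/funext => n; rewrite exprS.
  by rewrite -[X in _ --> X](mulr0 (0 : R)); exact: cvgM.
- by move=> n; exact: integrable_scaled_ones_dist.
- move=> n; under eq_fun do rewrite -exprM; exact: integrable_scaled_ones_dist.
- move=> n; under eq_Rintegral do rewrite -exprM.
  apply: (@le_trans _ _ (Ex (fun w => 2 ^+ (m * 2) * (Y n w ^+ (m * 2) + Sig w ^+ (m *
    2))))).
    apply: le_Rintegral => //; first exact: integrable_scaled_ones_dist.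
      apply: integrable_EFinM => //; apply: integrable_EFinD => //.
      exact: bdd_mfun_integrable.
    by move=> w _; apply: pow_absB_le; [exact: scaled_ones_ge0|exact: ones_limit_ge0].
  rewrite RintegralZl//; last first.
    by apply: integrable_EFinD => //; exact: bdd_mfun_integrable.
  rewrite ler_wpM2l ?exprn_ge0// RintegralD//; last exact: bdd_mfun_integrable.
  rewrite lerD2r; apply: le_trans (hB n).
  apply: Ex_le => //; first exact: bdd_mfun_scaled_rising.
  by move=> w; exact: scaled_onesX_le.
Qed.

(** Term by term integration of the exponential series of t Sigma. It is dominated
    by exp (|t| Sigma), which is integrable because its partial sums have bounded
    expectations. *)
Lemma ones_limit_mgf (t : R) :
  (\sum_(0 <= n < N) (t ^+ n / Gamma (1 + n%:R * a)))%:E @[N --> \oo] --> 'M_P Sig t.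
Proof.
pose h t N w : R := \sum_(0 <= k < N) t ^+ k / k`!%:R * Sig w ^+ k.
have hS t' N w : h t' N w = \sum_(0 <= k < N) (t' * Sig w) ^+ k / k`!%:R.
  by apply: eq_bigr => k _; rewrite exprMn mulrAC.
(* the partial sums are needed at t and, for domination, at |t| *)
have ih t' N : P.-integrable setT (EFin \o h t' N) /\
    Ex (h t' N) = \sum_(0 <= k < N) t' ^+ k / Gamma (1 + k%:R * a).
  elim: N => [|N [ih1 ih2]].
    rewrite big_geq// /h; split.
      under eq_fun do rewrite big_geq//; apply: bdd_mfun_integrable; exact: bdd_mfun_cst.
    under eq_Rintegral do rewrite big_geq//; exact: Ex_cst.
  have hN : h t' N.+1 = (fun w => h t' N w + t' ^+ N / N`!%:R * Sig w ^+ N).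
    by apply/funext => w; rewrite /h big_nat_recr.
  rewrite hN; split.
    by apply: integrable_EFinD => //; exact: integrable_EFinM.
  rewrite RintegralD//; last exact: integrable_EFinM.
  rewrite ih2 RintegralZl// Ex_ones_limitX big_nat_recr//=.
  by rewrite mulrA divfK// pnatr_eq0 -lt0n fact_gt0.
have EhE t' N : (\int[P]_w (h t' N w)%:E =
    (\sum_(0 <= k < N) t' ^+ k / Gamma (1 + k%:R * a))%:E)%E.
  by rewrite -(ih t' N).2 /Rintegral fineK//; apply: integrable_fin_num => //;
    exact: (ih t' N).1.
have mexp c : measurable_fun setT (fun w => expR (c * Sig w)).
  by apply: measurableT_comp => //; exact: measurable_funM.
have cvgh t' w : (h t' N w)%:E @[N --> \oo] --> (expR (t' * Sig w))%:E.
  apply: cvg_EFin; first exact: nearW.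
  rewrite (_ : fine \o _ = (fun N => \sum_(0 <= k < N) (t' * Sig w) ^+ k / k`!%:R)).
    exact: exp_partial_sum_cvg.
  by apply/funext => N /=; rewrite hS.
have mh t' N : measurable_fun setT (h t' N).
  by apply/measurable_EFinP; have /measurable_int := (ih t' N).1.
have h0 N w : 0 <= h `|t| N w.
  by apply: sumr_ge0 => k _; rewrite mulr_ge0 ?divr_ge0 ?exprn_ge0// ones_limit_ge0.
have iexp : P.-integrable setT (fun w => (expR (`|t| * Sig w))%:E).
  have [B hB] := Gamma_series_bounded a0 (normr_ge0 t).
  apply/integrableP; split; first exact/measurable_EFinP.
  under eq_integral do rewrite gee0_abs ?lee_fin ?expR_ge0//.
  apply: (@le_lt_trans _ _ B%:E); last exact: ltry.
  apply: (@fatou_le _ _ _ P (h `|t|)) => //.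
  - exact/measurable_EFinP.
  - by apply: aeW => w; exact: cvgh.
  - by move=> n; rewrite EhE lee_fin.
have [| | | | |_ _] := @dominated_convergence _ _ _ P setT measurableT
    (fun N w => (h t N w)%:E) (fun w => (expR (t * Sig w))%:E) (fun w => (expR (`|t| *
      Sig w))%:E).
- by move=> n; exact/measurable_EFinP.
- exact/measurable_EFinP.
- by apply: aeW => w _; exact: cvgh.
- exact: iexp.
- apply: aeW => w N _; rewrite lee_fin.
  apply: (@le_trans _ _ (h `|t| N w)); last first.
    by rewrite hS; apply: exp_partial_sum_le; rewrite mulr_ge0// ones_limit_ge0.
  apply: (le_trans (ler_norm_sum _ _ _)); apply: ler_sum => k _.
  rewrite !normrM normfV normrX (ger0_norm (ler0n _ _)).
  by rewrite (ger0_norm (exprn_ge0 k (ones_limit_ge0 w))).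
rewrite /mmt_gen_fun expectation.unlock => H.
rewrite (_ : (\int[P]_w _)%E = (\int[P]_w (expR (t * Sig w))%:E)%E); last first.
  by apply: eq_integral => w _ /=; rewrite mulrC.
by apply: cvg_trans H; apply: near_eq_cvg; apply: nearW => N; exact: EhE.
Qed.

(** Let phi be the rising factorial of order -1/2. The expectations of
    n^(a / 2) phi (S_n) are bounded. Where the limit is 0 these functions tend to
    infinity, since phi j is at least 1 / (2 sqrt j), and Fatou's lemma makes this
    event negligible. *)
Lemma ones_limit_gt0 : {ae P, forall w, 0 < Sig w}.
Proof.
have ha : 0 <= 2^-1 * a by rewrite mulr_ge0// ltW.
have a01' : 0 <= a <= 1 by rewrite ltW//; case/andP: a01.
have [C C0 hC] := euler_prod_inv_le ha.
pose A : set T := [set w | Sig w = 0].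
have mA : measurable A by have := mS measurableT (measurable_set1 0); rewrite setTI.
pose f n j : R := n%:R `^ (2^-1 * a) * rising_neg_half R j.
have f0 n j : 0 <= f n j.
  rewrite mulr_ge0 ?powR_ge0// /rising_neg_half mulr_ge0//.
  have := @euler_prod_half_gt0 R j 1; rewrite mulr1 => h; apply/ltW/h.
  by rewrite ler01 lexx.
(* restricting to A makes the limit explicit: infinite on A, 0 elsewhere *)
pose U n w := f n (S n w) * \1_A w.
pose V w := if Sig w == 0 then +oo%E else 0%E : \bar R.
have bf n : bdd_mfun (fun w => f n (S n w)) := bdd_mfun_nb_ones X (f n) n.
have bU n : bdd_mfun (U n) by apply: bdd_mfunM => //; exact: bdd_mfun_indic.
have mV : measurable_fun setT V.
  apply: measurable_fun_ifT => //.
  by apply: measurable_fun_eqr => //.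
have EU n : (\int[P]_w (U n w)%:E <= C%:E)%E.
  rewrite -[leLHS]fineK; last by apply: integrable_fin_num => //;
    exact: bdd_mfun_integrable.
  rewrite lee_fin; apply: (@le_trans _ _ (Ex (fun w => f n (S n w)))).
    apply: Ex_le => // w; rewrite /U indicE ler_piMr//.
    by case: (_ \in _).
  case: n => [|n].
    rewrite (_ : (fun w => _) = cst 0); first by rewrite Ex_cst ltW.
    by apply/funext => w; rewrite /f powR0 ?mul0r// gt_eqF ?mulr_gt0.
  rewrite ExZ; last exact: bdd_mfun_nb_ones.
  rewrite Ex_rising_neg_half//.
  have p0 : 0 < n.+1%:R `^ (2^-1 * a) :> R by rewrite powR_gt0.
  rewrite -ler_pdivlMl// [leRHS]mulrC.
  exact: le_trans (euler_prod_half_le _ a01') (hC _ _).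
have UV : {ae P, forall w, (U n w)%:E @[n --> \oo] --> V w}.
  apply: filterS2 first_one ae_cvg_scaled_ones => w S1 YS.
  rewrite /V; case: eqP => [S0|/eqP S0]; last first.
    rewrite (_ : (fun n => _) = cst 0%E); first exact: cvg_cst.
    apply/funext => n; rewrite /U indicE memNset ?mulr0//.
    by move=> /= /eqP; apply/negP.
  have wA : w \in A by rewrite inE.
  apply/cvgeryP; apply/cvgryPge => M.
  (* Y n w <= 1 / (4 M'^2) gives (f n (S n w))^2 >= M'^2 *)
  pose M' := Num.max M 1.
  have M0 : 0 < M' by rewrite lt_max ltr01 orbT.
  have e0 : 0 < (4 * M' ^+ 2)^-1 by rewrite invr_gt0 mulr_gt0// exprn_gt0.
  rewrite S0 in YS; move/cvgrPdist_le/(_ _ e0) : YS => YS.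
  near=> n.
  have n0 : (0 < n)%N by near: n; exact: nbhs_infty_gt.
  have Sn : (0 < S n w)%N.
    by rewrite -S1; apply: nb_ones_nondecreasing.
  have Yn : `|0 - Y n w| <= (4 * M' ^+ 2)^-1 by near: n.
  rewrite sub0r normrN ger0_norm ?scaled_ones_ge0// in Yn.
  rewrite /U indicE wA mulr1.
  apply: (@le_trans _ _ M'); first by rewrite le_max lexx.
  rewrite -(@ler_pXn2r _ 2) ?nnegrE ?f0 ?(ltW M0)//.
  have p0 : 0 < n%:R `^ a :> R by rewrite powR_gt0// ltr0n.
  have s0 : 0 < (S n w)%:R :> R by rewrite ltr0n.
  have hf := rising_neg_half_ge R Sn.
  have fE : f n (S n w) ^+ 2 = n%:R `^ a * rising_neg_half R (S n w) ^+ 2.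
    have -> : n%:R `^ a = (n%:R `^ (2^-1 * a)) ^+ 2 :> R.
      by rewrite -powR_mulrn ?powR_ge0// -powRrM; congr (_ `^ _); field.
    by rewrite /f exprMn.
  rewrite fE; move: Yn; rewrite /scaled_ones ler_pdivrMr// => Yn.
  have h1 : 4 * M' ^+ 2 * (S n w)%:R <= n%:R `^ a.
    by rewrite -ler_pdivlMl ?mulr_gt0 ?exprn_gt0.
  move: hf h1; move: (rising_neg_half R _ ^+ 2) (sqr_ge0 (rising_neg_half R (S n w)))
    => g g0 hf h1.
  have h2 : 4 * M' ^+ 2 * (S n w)%:R * g <= n%:R `^ a * g by apply: ler_wpM2r.
  apply: le_trans h2.
  have -> : 4 * M' ^+ 2 * (S n w)%:R * g = M' ^+ 2 * (4 * (S n w)%:R * g) by ring.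
  by rewrite ler_peMr// exprn_ge0// ltW.
have IV : P.-integrable setT V.
  apply/integrableP; split => //.
  rewrite (eq_integral V); last first.
    by move=> w _; rewrite /V; case: ifP => _ //=; rewrite normr0.
  apply: (@le_lt_trans _ _ C%:E); last exact: ltry.
  apply: (@fatou_le _ _ _ P U) => //.
  - by move=> n; have [] := bU n.
  - by move=> n w; rewrite mulr_ge0.
apply: filterS (integrable_ae measurableT IV) => w /(_ Logic.I).
by rewrite /V; case: eqP => // /eqP S0 _; rewrite lt_def S0 ones_limit_ge0.
Unshelve. all: by end_near. Qed.

End ones_chain.

(** * The elephant random walk with stops *)

Section number_of_ones.
Context d (T : measurableType d) (R : realType) (P : probability T R).
Variables (X : nat -> {RV P >-> R}).
Hypothesis sX : forall n, signs_upto X n.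

(** The square of a step is almost surely the indicator that it is nonzero. *)
Lemma ae_number_of_ones :
  {ae P, forall w, forall n, number_of_ones X n w = (nb_ones X n w)%:R}.
Proof.
apply: filterS (ae_foralln sX) => w sw n.
rewrite /number_of_ones /nb_ones natr_sum; apply: eq_big_nat => k /andP[k1 kn].
have := sw n k; rewrite k1 -ltnS kn => /(_ isT); rewrite !inE.
by case/or3P => /eqP->; rewrite ?sqrrN ?expr1n ?expr0n ?oppr_eq0 ?oner_eq0 ?eqxx.
Qed.

Lemma measurable_number_of_ones n : measurable_fun setT (number_of_ones X n).
Proof. by apply: measurable_sum => k; exact: measurable_funX. Qed.

End number_of_ones.

Theorem lemma2p1 (R : realType) (d : measure_display) (T : measurableType d)
    (P : probability T R) (p q r s : R) (X : nat -> {RV P >-> R})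
    (hp : 0 <= p <= 1) (hq : 0 <= q <= 1) (hr : 0 < r < 1)
    (hpqr : p + q + r = 1) (hs : 0 <= s <= 1)
    (hX : ERWS p q r s X) :
  exists Sigma : {RV P >-> R},
    [/\ {ae P, forall w,
          number_of_ones X n w / (n%:R `^ (1 - r)) @[n --> \oo] --> Sigma w},
        Mittag_Leffler (1 - r) Sigma,
        P [set w | 0 < Sigma w] = 1%E,
        forall m : nat, (1 <= m)%N ->
          cvg_Lm P m (fun n w => number_of_ones X n w / (n%:R `^ (1 - r))) Sigma &
        forall m : nat, (1 <= m)%N ->
          ('E_P[fun w => (Sigma w ^+ m)%R])%E =
          (m`!%:R / Gamma (1 + m%:R * (1 - r)))%:E].
Proof.
have [sX chain] := ERWS_ones_chain hpqr hX.
have a01 : 0 < 1 - r <= 1 by lra.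
have mSig := measurable_ones_limit X (1 - r).
have aeN := ae_number_of_ones sX.
exists (mfun_Sub (mem_set mSig)); split.
- apply: filterS2 aeN (ae_cvg_scaled_ones a01 chain) => w Nw Yw.
  rewrite (_ : (fun n => _) = (fun n => scaled_ones X (1 - r) n w))//.
  by apply/funext => n; rewrite Nw.
- by move=> t _; exact: ones_limit_mgf.
- have mpos : measurable [set w | 0 < ones_limit X (1 - r) w].
    have := mSig measurableT _ (measurable_itv `]0, +oo[).
    rewrite setTI; congr (measurable _).
    by apply/seteqP; split => w; rewrite /= in_itv/= andbT.
  have [N [mN N0 subN]] := ones_limit_gt0 a01 chain.
  apply/eqP; rewrite eq_le probability_le1//=.
  rewrite -(setCK [set w | _]) probability_setC; last exact: measurableC.
  rewrite (_ : P _ = 0%E) ?sube0//.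
  apply/eqP; rewrite -measure_le0 -N0; apply: le_measure; rewrite ?inE//.
  exact: measurableC.
- move=> m m0.
  have aeD n : {ae P, forall w, `|scaled_ones X (1 - r) n w - ones_limit X (1 - r) w| ^+ m
      = `|number_of_ones X n w / n%:R `^ (1 - r) - ones_limit X (1 - r) w| ^+ m}.
    by apply: filterS aeN => w ->.
  have aeY n : {ae P, forall w, `|scaled_ones X (1 - r) n w| ^+ m
      = `|number_of_ones X n w / n%:R `^ (1 - r)| ^+ m}.
    by apply: filterS aeN => w ->.
  have mN n : measurable_fun setT (fun w => number_of_ones X n w / n%:R `^ (1 - r)).
    by apply: measurable_funM => //; exact: measurable_number_of_ones.
  have mD n : measurable_fun setT
    (fun w => `|number_of_ones X n w / n%:R `^ (1 - r) - ones_limit X (1 - r) w| ^+ m).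
    by apply: measurable_funX; apply: measurableT_comp => //; exact: measurable_funB.
  have iD n := integrable_scaled_ones_dist a01 chain n m.
  have iN n := integrable_ae_eq (mD n) (aeD n) (iD n).
  split.
  + move=> n; apply: Lfun_nat => //.
    apply: (integrable_ae_eq _ (aeY n)).
      by apply: measurable_funX; exact: measurableT_comp.
    apply: bdd_mfun_integrable; apply: bdd_mfunX.
    have [my [M hM]] := bdd_mfun_scaled_ones X (1 - r) n.
    by split; [exact: measurableT_comp|exists M => w; rewrite normr_id].
  + apply: Lfun_nat => //.
    rewrite (_ : (fun w => _) = (fun w => ones_limit X (1 - r) w ^+ m)).
      exact: integrable_ones_limitX.
    by apply/funext => w; rewrite /= ger0_norm// ones_limit_ge0.
  + apply: Lnorm_nat_cvg0 => //.
    have := Ex_scaled_ones_dist_cvg0 a01 chain m0.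
    apply: cvg_trans; apply: near_eq_cvg; apply: nearW => n /=.
    apply: Ex_ae_eq => //.
    by have /measurable_int/measurable_EFinP := iD n.
- move=> m m0; rewrite expectation.unlock -(Ex_ones_limitX a01 chain) /Rintegral fineK//.
  by apply: integrable_fin_num => //; exact: integrable_ones_limitX.
Qed.
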